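(* The following hold. (i) The Banach space $\ell_\infty$ has a dense linear subspace that admits an equivalent analytic norm. (ii) Every separable Banach space $X$ has a dense linear subspace that admits an equivalent analytic norm. (iii) The Banach space $\ell_1(\mathfrak{c})$ has a dense linear subspace that admits an equivalent analytic norm, where $\mathfrak{c}$ denotes the cardinality of the continuum.
   Context: All spaces are real. A linear subspace $Y$ of a Banach space $X$ carries the restriction of the norm of $X$; ''$Y$ admits an equivalent analytic norm'' means there is a norm on $Y$, equivalent to the restricted norm, that is analytic. For normed spaces $X,Y$, let $\mathcal{P}(^nX;Y)$ be the space of continuous $n$-homogeneous polynomials from $X$ to $Y$. For $U\subseteq X$ open, a function $f\colon U\to Y$ is analytic if for every $a\in U$ there exist $\delta>0$ and $P_n\in\mathcal{P}(^nX;Y)$ ($n\in\mathbb{N}\cup\{0\}$) such that $f(x)=\sum_{n=0}^\infty P_n(x-a)$ for all $x$ in the open ball of centre $a$ and radius $\delta$. A norm on $X$ is analytic if it is an analytic real-valued function on $X\setminus\{0\}$. (Completeness of $X$ is not required.) *)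

(* Defs.v *)
From HB Require Import structures.
From mathcomp Require Import all_boot all_order all_algebra.
From mathcomp Require Import all_classical all_reals all_analysis.

Set Implicit Arguments.
Unset Strict Implicit.
Unset Printing Implicit Defensive.

Import Order.TTheory GRing.Theory Num.Theory.
Import numFieldNormedType.Exports.

Local Open Scope classical_set_scope.
Local Open Scope ring_scope.

Section Analytic.
Context {R : realType} {X Y : normedModType R}.

Definition multilinear (n : nat) (A : ('I_n -> X) -> Y) : Prop :=
  forall (i : 'I_n) (v : 'I_n -> X), linear (fun x => A [eta v with i |-> x]).

Definition homog_poly (n : nat) (P : X -> Y) : Prop :=
  exists2 A : ('I_n -> X) -> Y, multilinear A & forall x, P x = A (fun=> x).

Definition cont_homog_poly (n : nat) (P : X -> Y) : Prop :=
  homog_poly n P /\ continuous P.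

(* [f] is total but only its values on [U] matter: the ball on which the
   expansion holds is required to lie inside [U]. *)
Definition analytic (U : set X) (f : X -> Y) : Prop :=
  forall a, U a -> exists2 delta : R, 0 < delta &
    ball a delta `<=` U /\
    exists2 P : nat -> X -> Y, (forall n, cont_homog_poly n (P n)) &
      forall x, ball a delta x ->
        series (fun n => P n (x - a)) @ \oo --> f x.

End Analytic.

Definition analytic_norm (R : realType) (X : normedModType R) : Prop :=
  analytic [set x : X | x != 0] (fun x : X => `|x| : R).

Section Renorming.
Context {R : realType}.

Record norm_on (V : lmodType R) := NormOn {
  norm_fun :> V -> R;
  norm_onD : forall x y, norm_fun (x + y) <= norm_fun x + norm_fun y;
  norm_onZ : forall (l : R) x, norm_fun (l *: x) = `|l| * norm_fun x;
  norm_on_eq0 : forall x, norm_fun x = 0 -> x = 0 }.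

(* The vector space [V] as a normed space under [nu]; when [V] already carries
   a norm, that norm and its topology are forgotten. *)
Definition renormed (V : lmodType R) (nu : norm_on V) : Type := V.

HB.instance Definition _ (V : lmodType R) (nu : norm_on V) :=
  GRing.Lmodule.on (renormed nu).
HB.instance Definition _ (V : lmodType R) (nu : norm_on V) :=
  Lmodule_isNormed.Build R (renormed nu)
    (@norm_onD V nu) (@norm_onZ V nu) (@norm_on_eq0 V nu).

Definition equivalent_norm (Y : normedModType R) (nu : norm_on Y) : Prop :=
  exists c C : R,
    [/\ 0 < c, 0 < C & forall y : Y, c * `|y| <= nu y <= C * `|y| ].

Definition admits_equivalent_analytic_norm (Y : normedModType R) : Prop :=
  exists nu : norm_on Y, equivalent_norm nu /\ analytic_norm (renormed nu).

End Renorming.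

Section LinearSubspace.
Context {R : realType} {X : normedModType R}.

Definition lin_subspace (Y : submodClosed X) : Type := {x : X | x \in Y}.

HB.instance Definition _ (Y : submodClosed X) :=
  SubChoice.on (lin_subspace Y).
HB.instance Definition _ (Y : submodClosed X) :=
  [SubChoice_isSubLmodule of lin_subspace Y by <:].

Section Norm.
Variable Y : submodClosed X.
Implicit Types x y : lin_subspace Y.

Definition restr_norm x : R := `|val x|.

Lemma restr_normD x y : restr_norm (x + y) <= restr_norm x + restr_norm y.
Proof. by rewrite /restr_norm raddfD /= ler_normD. Qed.

Lemma restr_normZ (l : R) x : restr_norm (l *: x) = `|l| * restr_norm x.
Proof. by rewrite /restr_norm linearZ /= normrZ. Qed.

Lemma restr_norm_eq0 x : restr_norm x = 0 -> x = 0.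
Proof. by move=> /normr0_eq0 h; apply: val_inj; rewrite h raddf0. Qed.

HB.instance Definition _ := Lmodule_isNormed.Build R (lin_subspace Y)
  restr_normD restr_normZ restr_norm_eq0.
End Norm.
End LinearSubspace.

Definition has_dense_analytic_subspace (R : realType) (X : normedModType R) :
    Prop :=
  exists Y : submodClosed X,
    dense [set x : X | x \in Y] /\
    admits_equivalent_analytic_norm (lin_subspace Y).

Definition separable (T : topologicalType) : Prop :=
  exists2 D : set T, countable D & dense D.

Section EllInfty.
Variable R : realType.

Definition bounded_seq : {pred nat -> R} := [pred u | `[< bounded_fun u >]].

Lemma bounded_seqP (u : nat -> R) :
  reflect (exists M, forall n, `|u n| <= M) (u \in bounded_seq).
Proof.
apply: (iffP (asboolP (bounded_fun u))) => [/pinfty_ex_gt0[M _ uM]|[M uM]].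
  by exists M => n; exact: uM.
exists M; split; first exact: num_real.
by move=> N MN n _; exact: le_trans (uM n) (ltW MN).
Qed.

Lemma bounded_seq_submod : submod_closed bounded_seq.
Proof.
split; first by apply/bounded_seqP; exists 0 => n; rewrite normr0.
move=> l u v /bounded_seqP[M uM] /bounded_seqP[N vN].
apply/bounded_seqP; exists (`|l| * M + N) => n.
by rewrite (le_trans (ler_normD _ _))// lerD// normrM ler_wpM2l.
Qed.

HB.instance Definition _ :=
  GRing.isSubmodClosed.Build R (nat -> R) bounded_seq bounded_seq_submod.

Definition ell_infty : Type := {u : nat -> R | u \in bounded_seq}.

HB.instance Definition _ := SubChoice.on ell_infty.
HB.instance Definition _ := [SubChoice_isSubLmodule of ell_infty by <:].

Definition ell_infty_norm (u : ell_infty) : R :=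
  sup (range (fun n => `|val u n|)).

Lemma ell_infty_ub (u : ell_infty) n : `|val u n| <= ell_infty_norm u.
Proof.
have /bounded_seqP[M uM] := valP u.
apply: ub_le_sup; last by exists n.
by exists M => _ [k _ <-].
Qed.

Lemma ell_infty_lub (u : ell_infty) (M : R) :
  (forall n, `|val u n| <= M) -> ell_infty_norm u <= M.
Proof.
by move=> uM; apply: ge_sup => [|_ [k _ <-]//]; exists `|val u 0|, 0.
Qed.

Lemma ell_infty_normD (u v : ell_infty) :
  ell_infty_norm (u + v) <= ell_infty_norm u + ell_infty_norm v.
Proof.
apply: ell_infty_lub => n.
by rewrite (le_trans (ler_normD _ _))// lerD// ell_infty_ub.
Qed.

Lemma ell_infty_normZ (l : R) (u : ell_infty) :
  ell_infty_norm (l *: u) = `|l| * ell_infty_norm u.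
Proof.
have le (k : R) (w : ell_infty) :
    ell_infty_norm (k *: w) <= `|k| * ell_infty_norm w.
  by apply: ell_infty_lub => n; rewrite normrM ler_wpM2l// ell_infty_ub.
apply/le_anti; rewrite le /=.
have [->|l0] := eqVneq l 0.
  by rewrite normr0 mul0r (le_trans _ (ell_infty_ub _ 0%N)).
have := le l^-1 (l *: u).
by rewrite scalerA mulVf// scale1r normfV ler_pdivlMl ?normr_gt0.
Qed.

Lemma ell_infty_norm_eq0 (u : ell_infty) : ell_infty_norm u = 0 -> u = 0.
Proof.
move=> u0; apply/val_inj/funext => n.
by apply/normr0_eq0/eqP; rewrite eq_le normr_ge0 -u0 ell_infty_ub.
Qed.

HB.instance Definition _ := Lmodule_isNormed.Build R ell_infty
  ell_infty_normD ell_infty_normZ ell_infty_norm_eq0.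

End EllInfty.

Section EllOne.
Variables (R : realType) (T : choiceType).

Definition summable_fun : {pred T -> R} :=
  [pred f | `[< summable [set: T] (EFin \o f) >]].

Definition ell1_enorm (f : T -> R) : \bar R :=
  (\esum_(t in [set: T]) `|(f t)%:E|)%E.

Lemma ell1_enorm_ge0 f : (0 <= ell1_enorm f)%E.
Proof. exact: esum_ge0. Qed.

Lemma summable_funP f : reflect (ell1_enorm f < +oo)%E (f \in summable_fun).
Proof. exact: asboolP. Qed.

Lemma summable_fun_fin f : f \in summable_fun -> ell1_enorm f \is a fin_num.
Proof. by move/summable_funP; rewrite ge0_fin_numE// ell1_enorm_ge0. Qed.

Lemma ell1_enorm_ub f t : (`|(f t)%:E| <= ell1_enorm f)%E.
Proof.
apply: esum_ge; exists [set t]; last by rewrite fsbig_set1.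
by split => //; exact: finite_set1.
Qed.

Lemma ell1_enormD (f g : T -> R) : (ell1_enorm (f + g)%R <= ell1_enorm f + ell1_enorm g)%E.
Proof.
rewrite /ell1_enorm -esumD//; apply: le_esum => t _.
exact: (lee_abs_add (f t)%:E (g t)%:E).
Qed.

Lemma ell1_enormZ_le (l : R) f : f \in summable_fun ->
  (ell1_enorm (l *: f)%R <= `|l|%:E * ell1_enorm f)%E.
Proof.
move=> /summable_fun_fin ffin.
apply: ge_ereal_sup => _ [A [finA _] <-].
under eq_fsbigr => t _ do rewrite [(l *: f) t]/(l * f t) EFinM abseM.
rewrite -ge0_mule_fsumr//; apply: lee_wpmul2l => //.
by apply: esum_ge; exists A.
Qed.

Lemma summable_fun_submod : submod_closed summable_fun.
Proof.
split.
  apply/summable_funP; rewrite /ell1_enorm esum1// => t _.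
  by rewrite abse0.
move=> l f g fs gs; apply/summable_funP.
apply: (le_lt_trans (ell1_enormD _ _)).
apply: lte_add_pinfty; last exact/summable_funP.
apply: (le_lt_trans (ell1_enormZ_le _ fs)).
by rewrite -(fineK (summable_fun_fin fs)) -EFinM ltry.
Qed.

HB.instance Definition _ :=
  GRing.isSubmodClosed.Build R (T -> R) summable_fun summable_fun_submod.

Definition ell1 : Type := {f : T -> R | f \in summable_fun}.

HB.instance Definition _ := SubChoice.on ell1.
HB.instance Definition _ := [SubChoice_isSubLmodule of ell1 by <:].

Definition ell1_norm (f : ell1) : R := fine (ell1_enorm (val f)).

Lemma ell1_normE (f : ell1) : (ell1_norm f)%:E = ell1_enorm (val f).
Proof. by rewrite fineK// summable_fun_fin// (valP f). Qed.

Lemma ell1_normD (f g : ell1) : ell1_norm (f + g) <= ell1_norm f + ell1_norm g.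
Proof. by rewrite -lee_fin EFinD !ell1_normE ell1_enormD. Qed.

Lemma ell1_normZ (l : R) (f : ell1) : ell1_norm (l *: f) = `|l| * ell1_norm f.
Proof.
have le (k : R) (g : ell1) : ell1_norm (k *: g) <= `|k| * ell1_norm g.
  by rewrite -lee_fin EFinM !ell1_normE ell1_enormZ_le// (valP g).
apply/le_anti; rewrite le /=.
have [->|l0] := eqVneq l 0.
  by rewrite normr0 mul0r fine_ge0// ell1_enorm_ge0.
have := le l^-1 (l *: f).
by rewrite scalerA mulVf// scale1r normfV ler_pdivlMl ?normr_gt0.
Qed.

Lemma ell1_norm_eq0 (f : ell1) : ell1_norm f = 0 -> f = 0.
Proof.
move=> f0; apply/val_inj/funext => t.
apply/normr0_eq0/eqP; rewrite eq_le normr_ge0 andbT -lee_fin -f0 ell1_normE.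
exact: ell1_enorm_ub.
Qed.

HB.instance Definition _ := Lmodule_isNormed.Build R ell1
  ell1_normD ell1_normZ ell1_norm_eq0.

End EllOne.

(* Main.v *)
From HB Require Import structures.
Require Import Defs.
From mathcomp Require Import all_boot all_order all_algebra.
From mathcomp Require Import all_classical all_reals all_analysis.
From mathcomp Require Import ring lra.

(** Let [Y] carry countably many functionals [f_i], closed under negation, such
    that [m y = max_i f_i y] is attained for every [y] and defines an equivalent
    norm. With [E] a weighted average over [i], the gauge of the convex set
    [{y | E (1 / (1 - f_i y)) <= 2}] is an equivalent norm: since [m y] is
    attained at an atom of [E], [E (rho / (rho - f_i y))] blows up as [rho]
    decreases to [m y], so the gauge is the unique [rho > m y] at which this mean
    is [2]. At this [rho] the gap [rho - f_i y] is bounded below in [i], so the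
    equation can be solved by a power series. With the resolvent
    [psi_i = 1 / (rho - f_i y)] as an additional unknown, the system
    [psi_i * (rho - f_i y) = 1], [rho * E psi = 2] is bilinear, so that its formal
    solution has homogeneous coefficients with a quadratic majorant.

    In [ell_infty] take the coordinates on the finitely valued sequences; in
    [ell_1(c)] take countably many sign functions on [R] producing all finite sign
    patterns up to a global sign, on the finitely supported vectors. In a
    separable space, perturb a norming sequence of functionals along a bounded
    biorthogonal-like expansion so that each vector of a dense subspace sees only
    finitely many values. *)

Set Implicit Arguments.
Unset Strict Implicit.
Unset Printing Implicit Defensive.

Import Order.TTheory GRing.Theory Num.Theory.
Import numFieldNormedType.Exports.

Local Open Scope classical_set_scope.
Local Open Scope ring_scope.

(** * Uniformly bounded families of polynomials *)

Section Bpoly.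
Context {R : realType} {V : normedModType R} {I : Type}.
Implicit Types (P Q : I -> V -> R) (M N : R).

(** The bound sits on the multilinear forms and is the same for all [i], so that products multiply
    the bounds and a mean over [i] preserves them. *)
Definition bpoly (n : nat) M P : Prop :=
  exists A : I -> ('I_n -> V) -> R,
    [/\ forall i, @multilinear R V R n (A i),
        forall i v, `|A i v| <= M * \prod_(k < n) `|v k|
      & forall i x, P i x = A i (fun=> x)].

Lemma bpoly_bound n M P i x : bpoly n M P -> `|P i x| <= M * `|x| ^+ n.
Proof.
move=> [A [_ bA ->]]; rewrite (le_trans (bA _ _))//.
by rewrite prodr_const card_ord.
Qed.

Lemma bpoly_ext n M P Q : (forall i x, P i x = Q i x) -> bpoly n M P -> bpoly n M Q.
Proof. by move=> PQ [A [lA bA eA]]; exists A; split => // i x; rewrite -PQ. Qed.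

Lemma bpoly_le n M N P : M <= N -> bpoly n M P -> bpoly n N P.
Proof.
move=> MN [A [lA bA eA]]; exists A; split => // i v.
by rewrite (le_trans (bA _ _))// ler_wpM2r// prodr_ge0.
Qed.

Lemma bpoly_cst (c : I -> R) M : (forall i, `|c i| <= M) -> bpoly 0 M (fun i _ => c i).
Proof.
move=> cM; exists (fun i _ => c i); split => //; first by move=> i [].
by move=> i v; rewrite big_ord0 mulr1.
Qed.

Lemma bpoly_lin (f : I -> V -> R) M : (forall i, linear (f i : V -> R^o)) ->
  (forall i x, `|f i x| <= M * `|x|) -> bpoly 1 M f.
Proof.
move=> lf fM; exists (fun i v => f i (v ord0)); split => //.
  by move=> i k v l x y /=; rewrite !ord1 eqxx lf.
by move=> i v; rewrite big_ord1.
Qed.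

Lemma bpoly0 n : bpoly n 0 (fun _ _ => 0).
Proof.
exists (fun _ _ => 0); split => //; first by move=> i k v l x y; rewrite scaler0 addr0.
by move=> i v; rewrite normr0 mul0r.
Qed.

Lemma bpolyD n M N P Q : bpoly n M P -> bpoly n N Q ->
  bpoly n (M + N) (fun i x => P i x + Q i x).
Proof.
move=> [A [lA bA eA]] [B [lB bB eB]]; exists (fun i v => A i v + B i v); split.
- by move=> i k v l x y; rewrite lA lB scalerDr addrACA.
- by move=> i v; rewrite mulrDl (le_trans (ler_normD _ _))// lerD.
- by move=> i x; rewrite eA eB.
Qed.

Lemma bpolyN n M P : bpoly n M P -> bpoly n M (fun i x => - P i x).
Proof.
move=> [A [lA bA eA]]; exists (fun i v => - A i v); split.
- by move=> i k v l x y; rewrite lA scalerN opprD.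
- by move=> i v; rewrite normrN.
- by move=> i x; rewrite eA.
Qed.

Lemma bpoly_sum (J : Type) (s : seq J) (p : pred J) n (M : J -> R) (P : J -> I -> V -> R) :
  (forall j, p j -> bpoly n (M j) (P j)) ->
  bpoly n (\sum_(j <- s | p j) M j) (fun i x => \sum_(j <- s | p j) P j i x).
Proof.
move=> bP; elim: s => [|j s IH].
  by rewrite big_nil; apply: bpoly_ext (bpoly0 n) => i x; rewrite big_nil.
rewrite big_cons; case: ifPn => pj.
  apply: bpoly_ext (bpolyD (bP _ pj) IH) => i x.
  by rewrite big_cons pj.
by apply: bpoly_ext IH => i x; rewrite big_cons (negbTE pj).
Qed.

Lemma with_lshift (n m : nat) (v : 'I_(n + m) -> V) (k : 'I_(n + m)) (j : 'I_n) (x : V) :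
  fintype.split k = inl j ->
  (fun i => [eta v with k |-> x] (lshift m i)) = [eta fun i => v (lshift m i) with j |-> x] /\
  (fun i => [eta v with k |-> x] (rshift n i)) = (fun i => v (rshift n i)).
Proof.
move=> kj; have -> : k = lshift m j by rewrite -[k]splitK kj.
split; apply/funext => i /=; first by rewrite eq_lshift.
by rewrite eq_rlshift.
Qed.

Lemma with_rshift (n m : nat) (v : 'I_(n + m) -> V) (k : 'I_(n + m)) (j : 'I_m) (x : V) :
  fintype.split k = inr j ->
  (fun i => [eta v with k |-> x] (lshift m i)) = (fun i => v (lshift m i)) /\
  (fun i => [eta v with k |-> x] (rshift n i)) = [eta fun i => v (rshift n i) with j |-> x].
Proof.
move=> kj; have -> : k = rshift n j by rewrite -[k]splitK kj.
split; apply/funext => i /=; last by rewrite eq_rshift.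
by rewrite eq_lrshift.
Qed.

(** The two forms are evaluated on the first [n] and the last [m] arguments. The degree [k] is tied
    to [n + m] by an equation, so that degrees such as [j + (n.+1 - j)] fit without casts. *)
Lemma bpolyM n m k M N P Q : (n + m)%N = k -> 0 <= M -> bpoly n M P -> bpoly m N Q ->
  bpoly k (M * N) (fun i x => P i x * Q i x).
Proof.
move=> <- M0 [A [lA bA eA]] [B [lB bB eB]].
exists (fun i v => A i (fun j => v (lshift m j)) * B i (fun j => v (rshift n j))); split.
- move=> i k' v l x y.
  case kj : (fintype.split k') => [j|j].
    rewrite !(with_lshift _ _ kj).1 !(with_lshift _ _ kj).2 lA mulrDl.
    by congr (_ + _); rewrite /GRing.scale/= mulrA.
  rewrite !(with_rshift _ _ kj).1 !(with_rshift _ _ kj).2 lB mulrDr.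
  by congr (_ + _); rewrite /GRing.scale/= mulrCA.
- move=> i v; rewrite normrM big_split_ord/= mulrACA ler_pM//.
- by move=> i x; rewrite eA eB.
Qed.

(** Replacing [y] by [x] one argument at a time takes [n] steps, each costing at most
    [M * c ^+ n.-1] times the norm of [x - y]. *)
Lemma multilinear_telescope n (A : ('I_n -> V) -> R) M x y c :
  @multilinear R V R n A -> (forall v, `|A v| <= M * \prod_(k < n) `|v k|) ->
  `|x| <= c -> `|y| <= c -> 0 <= M ->
  `|A (fun=> x) - A (fun=> y)| <= M * c ^+ n.-1 *+ n * `|x - y|.
Proof.
move=> lA bA xc yc M0.
have c0 : 0 <= c by exact: le_trans xc.
pose v (j : nat) : 'I_n -> V := fun k => if (k < j)%N then x else y.
have -> : A (fun=> x) = A (v n) by congr A; apply/funext => k; rewrite /v ltn_ord.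
have -> : A (fun=> y) = A (v 0) by congr A; apply/funext.
rewrite -(telescope_sumr (fun j => A (v j)))// (le_trans (ler_norm_sum _ _ _))//.
have -> : M * c ^+ n.-1 *+ n * `|x - y| = \sum_(k < n) M * c ^+ n.-1 * `|x - y|.
  by rewrite sumr_const card_ord mulrnAl.
rewrite big_mkord ler_sum//= => -[k kn] _ /=.
set k' := Ordinal kn.
have -> : v k.+1 = [eta v k with k' |-> x].
  apply/funext => j; rewrite /v/= ltnS leq_eqVlt.
  have [->|jk] := eqVneq j k'; first by rewrite /= eqxx.
  by rewrite (_ : (nat_of_ord j == k) = false)//; exact/negbTE.
have {2}-> : v k = [eta v k with k' |-> y].
  apply/funext => j; rewrite /v/=.
  by have [->//=|//] := eqVneq j k'; rewrite ltnn.
have -> : A [eta v k with k' |-> x] - A [eta v k with k' |-> y] =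
          A [eta v k with k' |-> x - y].
  have := lA k' (v k) (-1) y x; rewrite scaleN1r [- y + x]addrC => ->.
  by rewrite scaleN1r addrC.
rewrite (le_trans (bA _))// -mulrA ler_wpM2l//.
rewrite (bigD1 k')//= eqxx [leLHS]mulrC ler_wpM2r//.
have -> : c ^+ n.-1 = \prod_(i < n | i != k') c.
  rewrite prodr_const; congr (_ ^+ _).
  by rewrite cardC1 card_ord.
apply: ler_prod => j /negbTE jk; rewrite jk normr_ge0/= /v; by case: ifP.
Qed.

Lemma bpoly_continuous n M P i : 0 <= M -> bpoly n M P -> continuous (P i).
Proof.
move=> M0 [A [lA bA eA]] x.
apply/(@cvgrPdist_lt _ R^o) => e e0.
(* [c] bounds the norms of [x] and of every [y] within distance [1] of it; the [+ 1] in [L] makes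
   [L] positive. *)
pose c := `|x| + 1.
pose L := M * c ^+ n.-1 *+ n + 1.
have L0 : 0 < L by rewrite ltr_wpDl// mulrn_wge0// mulr_ge0// exprn_ge0// addr_ge0.
near=> y.
rewrite !eA (le_lt_trans (@multilinear_telescope n (A i) M x y c _ _ _ _ _))//.
- by rewrite lerDl.
- rewrite -(subrK x y) addrC (le_trans (ler_normD _ _))// lerD2l distrC.
  near: y; apply/nbhs_ballP; exists 1 => //= y; rewrite -ball_normE/= => /ltW//.
- apply: (@le_lt_trans _ _ (L * `|x - y|)).
    by rewrite ler_wpM2r// lerDl.
  rewrite mulrC -ltr_pdivlMr//.
  near: y; apply/nbhs_ballP; exists (e / L); first by rewrite /= divr_gt0.
  by move=> y; rewrite -ball_normE/=.
Unshelve. all: by end_near.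
Qed.

Lemma bpoly_cont_homog n M P i : 0 <= M -> bpoly n M P -> @cont_homog_poly R V R n (P i).
Proof.
move=> M0 bP; split; last exact: bpoly_continuous bP.
by case: bP => A [lA _ eA]; exists (A i).
Qed.

End Bpoly.

(** * Means and the resolvent norm *)

Section Mean.
Context {R : realType} {I : Type}.
Implicit Types (c d : I -> R) (E : (I -> R) -> R).

Definition bfun c := exists M : R, forall i, `|c i| <= M.

(** Only bounded functions are constrained. The positive weight in [mean_atom] forces the mean of
    the resolvent up to [2] as [rho] approaches a maximum attained at that index. *)
Record is_mean E : Prop := IsMean {
  mean_lin : forall a c d, bfun c -> bfun d ->
    E (fun i => a * c i + d i) = a * E c + E d;
  mean_ge0 : forall c, bfun c -> (forall i, 0 <= c i) -> 0 <= E c;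
  mean_one : E (fun=> 1) = 1;
  mean_atom : forall i, exists2 w : R, 0 < w &
    forall c, bfun c -> (forall j, 0 <= c j) -> w * c i <= E c }.

Lemma bfun_cst (a : R) : bfun (fun=> a).
Proof. by exists `|a|. Qed.

Lemma bfunM c d : bfun c -> bfun d -> bfun (fun i => c i * d i).
Proof. by move=> [M cM] [N dN]; exists (M * N) => i; rewrite normrM ler_pM. Qed.

Lemma bfunD c d : bfun c -> bfun d -> bfun (fun i => c i + d i).
Proof.
move=> [M cM] [N dN]; exists (M + N) => i.
by rewrite (le_trans (ler_normD _ _))// lerD.
Qed.

Lemma bfunN c : bfun c -> bfun (fun i => - c i).
Proof. by move=> [M cM]; exists M => i; rewrite normrN. Qed.

Variable E : (I -> R) -> R.
Hypothesis hE : is_mean E.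

Lemma meanD c d : bfun c -> bfun d -> E (fun i => c i + d i) = E c + E d.
Proof.
move=> bc bd; rewrite -[E c]mul1r -(mean_lin hE)//.
by congr E; apply/funext => i; rewrite mul1r.
Qed.

Lemma mean_cst a : E (fun=> a) = a.
Proof.
have E0 : E (fun=> 0) = 0.
  have := mean_lin hE 1 (bfun_cst 0) (bfun_cst 0).
  under eq_fun do rewrite mul1r addr0.
  by rewrite mul1r => /eqP; rewrite -subr_eq0 opprD addNKr oppr_eq0 => /eqP.
have := mean_lin hE a (bfun_cst 1) (bfun_cst 0).
under eq_fun do rewrite mulr1 addr0.
by rewrite (mean_one hE) E0 mulr1 addr0.
Qed.

Lemma meanZ a c : bfun c -> E (fun i => a * c i) = a * E c.
Proof.
move=> bc; have := mean_lin hE a bc (bfun_cst 0).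
by under eq_fun do rewrite addr0; rewrite mean_cst addr0.
Qed.

Lemma meanB c d : bfun c -> bfun d -> E (fun i => c i - d i) = E c - E d.
Proof.
move=> bc bd; rewrite [RHS]addrC -mulN1r -(mean_lin hE)//.
by congr E; apply/funext => i; rewrite mulN1r addrC.
Qed.

Lemma mean_le c d : bfun c -> bfun d -> (forall i, c i <= d i) -> E c <= E d.
Proof.
move=> bc bd cd; rewrite -subr_ge0 -meanB//; apply: (mean_ge0 hE).
  exact/bfunD/bfunN.
by move=> i; rewrite subr_ge0.
Qed.

Lemma mean_norm_le c M : (forall i, `|c i| <= M) -> `|E c| <= M.
Proof.
move=> cM; have bc : bfun c by exists M.
have bM : bfun (fun=> M) by exact: bfun_cst.
rewrite ler_norml -{1}(mean_cst (- M)) -{2}(mean_cst M) !mean_le//.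
- by move=> i; have := cM i; rewrite ler_norml => /andP[].
- exact: bfun_cst.
- by move=> i; have := cM i; rewrite ler_norml => /andP[].
Qed.

End Mean.

Section BpolyMean.
Context {R : realType} {V : normedModType R} {I : Type}.

(** [E] is applied to the multilinear forms themselves; the result is a family constant in the
    index. *)
Lemma bpoly_mean (E : (I -> R) -> R) n (M : R) (P : I -> V -> R) : is_mean E ->
  bpoly n M P -> bpoly n M (fun (_ : I) x => E (P^~ x)).
Proof.
move=> hE [A [lA bA eA]]; exists (fun _ v => E (A^~ v)); split.
- move=> _ k v l x y.
  have bfA u : bfun (A^~ u) by exists (M * \prod_(k < n) `|u k|).
  rewrite [LHS](_ : _ = E (fun i => l * A i [eta v with k |-> x] + A i [eta v with k |-> y])).
    by rewrite (mean_lin hE).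
  by congr E; apply/funext => i; rewrite lA.
- by move=> i v; apply: (mean_norm_le hE).
- by move=> i x; congr E; apply/funext => j; rewrite eA.
Qed.

End BpolyMean.

Section ResolventNorm.
Context {R : realType} {V : lmodType R} {I : Type}.
Variables (E : (I -> R) -> R) (s : I -> I) (f : I -> V -> R).
Hypothesis hE : is_mean E.
Hypothesis Esym : forall c, bfun c -> E (c \o s) = E c.
Hypothesis f_lin : forall i, linear (f i : V -> R^o).
Hypothesis f_sym : forall i x, f (s i) x = - f i x.
Hypothesis f_max : forall x, exists i, forall j, f j x <= f i x.
Hypothesis f_sep : forall x, (forall i, f i x = 0) -> x = 0.

Let fD i x y : f i (x + y) = f i x + f i y.
Proof. by have := f_lin i 1 x y; rewrite !scale1r. Qed.

Let f0 i : f i 0 = 0.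
Proof. by have /eqP := fD i 0 0; rewrite addr0 -subr_eq0 opprD addNKr oppr_eq0 => /eqP. Qed.

Let fZ i l x : f i (l *: x) = l * f i x.
Proof. by have := f_lin i l x 0; rewrite !addr0 f0 addr0. Qed.

(** The factor [rho] makes this invariant under joint positive scaling of [x] and [rho], with value
    [1] at [x = 0] when [rho > 0]. *)
Definition resolvent x (rho : R) i := rho / (rho - f i x).

(** A gap uniform in [i] keeps the resolvent bounded, hence within the scope of [E]. Since maxima
    are attained, strict pointwise domination already yields it. *)
Definition dominates x (rho : R) := exists2 d : R, 0 < d & forall i, d <= rho - f i x.

Lemma dominates_gt x rho i : dominates x rho -> f i x < rho.
Proof. by move=> [d d0 H]; rewrite -subr_gt0 (lt_le_trans d0). Qed.

Lemma dominatesP x rho : (forall i, f i x < rho) -> dominates x rho.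
Proof.
have [i fi] := f_max x; move=> H; exists (rho - f i x); first by rewrite subr_gt0.
by move=> j; rewrite lerD2l lerN2.
Qed.

Lemma dominates_norm x rho i : dominates x rho -> `|f i x| < rho.
Proof.
move=> H; rewrite ltr_norml (dominates_gt _ H) andbT ltrNl -f_sym.
exact: dominates_gt H.
Qed.

Lemma dominates_gt0 x rho : dominates x rho -> 0 < rho.
Proof.
have [i _] := f_max x => /(dominates_norm i); exact: le_lt_trans.
Qed.

Lemma resolvent_bfun x rho : dominates x rho -> bfun (resolvent x rho).
Proof.
move=> H; have r0 := dominates_gt0 H; have [d d0 Hd] := H.
exists (rho / d) => i; have p : 0 < rho - f i x by exact: lt_le_trans (Hd i).
rewrite normrM (gtr0_norm r0) gtr0_norm ?invr_gt0// ler_pM2l//.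
by rewrite lef_pV2// posrE.
Qed.

Lemma resolvent_gt0 x rho i : dominates x rho -> 0 < resolvent x rho i.
Proof.
move=> H; rewrite divr_gt0 ?subr_gt0 ?(dominates_gt0 H)//; exact: dominates_gt H.
Qed.

(** For each [i], [rho ^+ 2 / (rho - f i x)] is the square of a linear quantity over a positive
    linear one, hence subadditive in the pair of [x] and [rho]; the defect is an explicit square
    over a positive denominator. *)
Lemma resolvent_convex x y r1 r2 : dominates x r1 -> dominates y r2 ->
  dominates (x + y) (r1 + r2) /\
  (r1 + r2) * E (resolvent (x + y) (r1 + r2)) <=
    r1 * E (resolvent x r1) + r2 * E (resolvent y r2).
Proof.
move=> H1 H2; have H : dominates (x + y) (r1 + r2).
  by apply: dominatesP => i; rewrite fD ltrD//; exact: dominates_gt.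
have b1 := resolvent_bfun H1; have b2 := resolvent_bfun H2.
have b := resolvent_bfun H.
split => //; rewrite -!(meanZ hE)// -(meanD hE)//; [|by apply: bfunM => //; exact: bfun_cst..].
apply: (mean_le hE).
- by apply: bfunM => //; exact: bfun_cst.
- by apply: bfunD; apply: bfunM => //; exact: bfun_cst.
move=> i; rewrite /resolvent fD.
set a1 := r1 - f i x; set a2 := r2 - f i y.
have a10 : 0 < a1 by rewrite subr_gt0; exact: dominates_gt.
have a20 : 0 < a2 by rewrite subr_gt0; exact: dominates_gt.
have -> : r1 + r2 - (f i x + f i y) = a1 + a2 by rewrite /a1 /a2; ring.
rewrite -subr_ge0.
have -> : r1 * (r1 / a1) + r2 * (r2 / a2) - (r1 + r2) * ((r1 + r2) / (a1 + a2)) =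
  (r1 * a2 - r2 * a1) ^+ 2 / (a1 * a2 * (a1 + a2)).
  by field; rewrite !gt_eqF // addr_gt0.
by rewrite divr_ge0 ?sqr_ge0// ltW// !mulr_gt0// addr_gt0.
Qed.

(** Write [x = x + 0] and [r' = r + (r' - r)], the resolvent at [0] being [1]: convexity bounds [r']
    times the new mean by [2 * r + (r' - r)], which is below [2 * r']. *)
Lemma resolvent_mean_lt x r r' : dominates x r -> E (resolvent x r) <= 2 -> r < r' ->
  dominates x r' /\ E (resolvent x r') < 2.
Proof.
move=> H E2 rr'; have H0 : dominates 0 (r' - r).
  by apply: dominatesP => i; rewrite f0 subr_gt0.
have [] := resolvent_convex H H0; rewrite addr0 subrKC => H'.
have -> : resolvent 0 (r' - r) = fun=> 1.
  by apply/funext => i; rewrite /resolvent f0 subr0 divff// gt_eqF// subr_gt0.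
rewrite (mean_cst hE) mulr1 => le; split=> //.
have r0 := dominates_gt0 H.
rewrite -(ltr_pM2l (dominates_gt0 H')); apply: le_lt_trans le _.
have : r * E (resolvent x r) <= r * 2 by rewrite ler_pM2l.
lra.
Qed.

Definition gauge x rho := dominates x rho /\ E (resolvent x rho) = 2.

Lemma gauge_uniq x r r' : gauge x r -> gauge x r' -> r = r'.
Proof.
move=> [H e] [H' e'].
have [/(resolvent_mean_lt H)|/(resolvent_mean_lt H')|//] := ltgtP r r'.
  by rewrite e e' => /(_ (lexx _))[_]; rewrite ltxx.
by rewrite e e' => /(_ (lexx _))[_]; rewrite ltxx.
Qed.

Lemma gauge_neq0 x r : gauge x r -> x != 0.
Proof.
move=> [H]; apply: contra_eqN => /eqP x0.
have -> : resolvent x r = fun=> 1.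
  apply/funext => i; rewrite /resolvent x0 f0 subr0 divff// gt_eqF//.
  exact: dominates_gt0 H.
by rewrite (mean_one hE) -subr_eq0 (_ : 1 - 2 = -1 :> R) ?oppr_eq0 ?oner_eq0//; ring.
Qed.

Lemma resolvent_lipschitz x (d r r' : R) : 0 < d -> (forall i, d <= r - f i x) ->
  (forall i, d <= r' - f i x) ->
  `|E (resolvent x r) - E (resolvent x r')| <= r / d ^+ 2 * `|r - r'|.
Proof.
move=> d0 Hr Hr'; have D : dominates x r by exists d.
have D' : dominates x r' by exists d.
rewrite -(meanB hE); [|exact: resolvent_bfun..].
apply: (mean_norm_le hE) => i; rewrite /resolvent.
have a0 : 0 < r - f i x by exact: lt_le_trans (Hr i).
have a0' : 0 < r' - f i x by exact: lt_le_trans (Hr' i).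
have -> : r / (r - f i x) - r' / (r' - f i x) =
   f i x / ((r - f i x) * (r' - f i x)) * (r' - r).
  by field; rewrite !gt_eqF.
rewrite normrM distrC ler_wpM2r// normrM ler_pM//.
  exact/ltW/dominates_norm.
rewrite normfV lef_pV2 ?posrE ?exprn_gt0//; last by rewrite normr_gt0 gt_eqF ?mulr_gt0.
by rewrite gtr0_norm ?mulr_gt0// expr2 ler_pM// ltW.
Qed.

Lemma max_gt0 x : x != 0 -> exists i, (forall j, f j x <= f i x) /\ 0 < f i x.
Proof.
move=> x0; have [i fi] := f_max x; exists i; split => //.
rewrite ltNge; apply: contra_neqN x0 => fi0; apply: f_sep => j.
apply/eqP; rewrite eq_le (le_trans (fi j) fi0)/=.
by rewrite -oppr_le0 -f_sym (le_trans (fi _) fi0).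
Qed.

(** The intermediate value theorem is applied to the mean of the resolvent, as a function of the
    radius, between [r1 > m] and [2 * m]. *)
Lemma gauge_ex x : x != 0 -> exists rho, gauge x rho.
Proof.
move=> /max_gt0[i [fi]]; set m := f i x => m0.
have [w w0 Hw] := mean_atom hE i.
have w1 : w <= 1.
  by rewrite -(mean_one hE) -[w]mulr1; apply: Hw => //; exact: bfun_cst.
(* At [r1] the atom [i] alone contributes [w * (1 + w / 2) / (w / 2) = 2 + w]; at [2 * m] every
   resolvent is at most [2]. *)
pose r1 := m * (1 + w / 2).
pose d := m * (w / 2).
have d0 : 0 < d by rewrite mulr_gt0// divr_gt0.
have dr1 : d = r1 - m by rewrite /d /r1; ring.
have r1r2 : r1 <= 2 * m by rewrite /r1 mulrC ler_pM2r//; lra.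
have Hd r : r1 <= r -> forall j, d <= r - f j x.
  by move=> rr j; rewrite dr1 lerB.
have D r : r1 <= r -> dominates x r by move=> rr; exists d => //; exact: Hd.
pose g r := E (resolvent x r).
have g_cont : {within `[r1, 2 * m], continuous g}.
  apply: continuous_in_subspaceT => r; rewrite inE/= in_itv/= => /andP[ra rb].
  apply/(@cvgrPdist_lt _ R^o) => e e0.
  (* Half of the gap is given up so that all radii close to [r] share the gap [d2]. *)
  pose d2 := d / 2; have d20 : 0 < d2 by rewrite divr_gt0.
  have r0 : 0 < r by exact: dominates_gt0 (D _ ra).
  pose L := r / d2 ^+ 2 + 1.
  have L0 : 0 < L by rewrite ltr_wpDl// divr_ge0 ?exprn_ge0// ltW.
  near=> y.
  have ry : `|r - y| < d2 by near: y; apply: (@cvgr_dist_lt _ R^o); [exact: cvg_id|].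
  rewrite (le_lt_trans (resolvent_lipschitz d20 _ _))//.
  - by move=> j; rewrite (le_trans _ (Hd _ ra j))// /d2; lra.
  - move=> j; have := Hd _ ra j; move: ry; rewrite ltr_norml /d2 => /andP[]; lra.
  apply: (@le_lt_trans _ _ (L * `|r - y|)); first by rewrite ler_wpM2r// lerDl.
  rewrite mulrC -ltr_pdivlMr//.
  by near: y; apply: (@cvgr_dist_lt _ R^o); [exact: cvg_id|rewrite divr_gt0].
have g1 : 2 <= g r1.
  apply: le_trans (Hw _ (resolvent_bfun (D _ (lexx _))) _); last first.
    by move=> j; apply/ltW/resolvent_gt0/D.
  rewrite /resolvent -/m -dr1 mulrA ler_pdivlMr// /d /r1.
  have : 0 <= w * m * w by rewrite !mulr_ge0// ltW.
  lra.
have g2 : g (2 * m) <= 2.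
  rewrite -[leRHS](mean_cst hE) (mean_le hE)//.
  - exact/resolvent_bfun/D.
  - exact: bfun_cst.
  move=> j; rewrite /resolvent ler_pdivrMr; last by rewrite subr_gt0; exact/dominates_gt/D.
  by have := fi j; rewrite -/m; lra.
have [|r rin gr] := @IVT R g r1 (2 * m) 2 r1r2 g_cont.
  by rewrite ge_min g2 orbT le_max g1.
by exists r; move: rin; rewrite in_itv/= => /andP[ra rb]; split; first exact: D.
Unshelve. all: end_near.
Qed.

Definition resolvent_norm x : R := if x == 0 then 0 else xget 0 (gauge x).

Lemma resolvent_normP x : x != 0 -> gauge x (resolvent_norm x).
Proof.
move=> x0; rewrite /resolvent_norm (negbTE x0).
by have [r Hr] := gauge_ex x0; exact: (xgetPex 0 (ex_intro _ r Hr)).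
Qed.

Lemma resolvent_norm_uniq x r : gauge x r -> resolvent_norm x = r.
Proof.
by move=> H; apply: (gauge_uniq _ H); exact/resolvent_normP/(gauge_neq0 H).
Qed.

Lemma resolvent_norm0 : resolvent_norm 0 = 0.
Proof. by rewrite /resolvent_norm eqxx. Qed.

Lemma resolvent_norm_gt0 x : x != 0 -> 0 < resolvent_norm x.
Proof. by move=> /resolvent_normP[/dominates_gt0]. Qed.

Lemma resolvent_norm_ge x i : `|f i x| <= resolvent_norm x.
Proof.
have [->|x0] := eqVneq x 0; first by rewrite f0 normr0 resolvent_norm0.
by have [H _] := resolvent_normP x0; exact/ltW/dominates_norm.
Qed.

Lemma resolvent_norm_eq0 x : resolvent_norm x = 0 -> x = 0.
Proof. by apply: contra_eq => /resolvent_norm_gt0; rewrite lt0r => /andP[]. Qed.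

Lemma le_resolvent_norm x r : dominates x r -> E (resolvent x r) <= 2 ->
  resolvent_norm x <= r.
Proof.
move=> H Er; have [->|x0] := eqVneq x 0; first by rewrite resolvent_norm0 ltW// (dominates_gt0 H).
have [_ e2] := resolvent_normP x0; rewrite leNgt; apply/negP.
by move=> /(resolvent_mean_lt H Er)[_]; rewrite e2 ltxx.
Qed.

(** At radius [2 * m] every resolvent is at most [2], hence so is the mean. *)
Lemma resolvent_norm_le x m : (forall i, f i x <= m) -> resolvent_norm x <= 2 * m.
Proof.
move=> fm; have [x0|x0] := eqVneq x 0.
  by have [i _] := f_max 0; have := fm i; rewrite x0 resolvent_norm0 f0 => ?; rewrite mulr_ge0.
have [i [_ fi]] := max_gt0 x0.
have m0 : 0 < m by exact: lt_le_trans (fm i).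
have D : dominates x (2 * m) by apply: dominatesP => j; have := fm j; lra.
apply: le_resolvent_norm => //.
rewrite -[leRHS](mean_cst hE) (mean_le hE)//; [exact: resolvent_bfun|exact: bfun_cst|].
move=> j; rewrite /resolvent ler_pdivrMr; last by rewrite subr_gt0; exact: dominates_gt.
by have := fm j; lra.
Qed.

Lemma resolvent_normD x y :
  resolvent_norm (x + y) <= resolvent_norm x + resolvent_norm y.
Proof.
have [->|x0] := eqVneq x 0; first by rewrite resolvent_norm0 !add0r.
have [->|y0] := eqVneq y 0; first by rewrite resolvent_norm0 !addr0.
have [H1 e1] := resolvent_normP x0; have [H2 e2] := resolvent_normP y0.
have [H] := resolvent_convex H1 H2; rewrite e1 e2 -mulrDl ler_pM2l ?(dominates_gt0 H)//.
exact: le_resolvent_norm.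
Qed.

Let resolvent_normZ_gt0 l x : 0 < l -> resolvent_norm (l *: x) = l * resolvent_norm x.
Proof.
move=> l0; have [->|x0] := eqVneq x 0; first by rewrite scaler0 resolvent_norm0 mulr0.
have [H e] := resolvent_normP x0; apply: resolvent_norm_uniq; split.
  by apply: dominatesP => i; rewrite fZ ltr_pM2l// dominates_gt.
rewrite -e; congr E; apply/funext => i; rewrite /resolvent fZ.
by rewrite -mulrBr -mulf_div divff ?mul1r ?gt_eqF.
Qed.

Let resolvent_normN x : resolvent_norm (- x) = resolvent_norm x.
Proof.
have [->|x0] := eqVneq x 0; first by rewrite oppr0.
have [H e] := resolvent_normP x0; apply: resolvent_norm_uniq; split.
  by apply: dominatesP => i; rewrite -scaleN1r fZ mulN1r -f_sym dominates_gt.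
rewrite -e -[RHS]Esym; last exact: resolvent_bfun.
congr E; apply/funext => i; rewrite /resolvent/= f_sym.
by rewrite -scaleN1r fZ mulN1r.
Qed.

Lemma resolvent_normZ l x : resolvent_norm (l *: x) = `|l| * resolvent_norm x.
Proof.
have [l0|l0|->] := ltgtP l 0.
- rewrite -[l]opprK scaleNr resolvent_normN resolvent_normZ_gt0 ?oppr_gt0//.
  by rewrite normrN gtr0_norm// oppr_gt0.
- by rewrite resolvent_normZ_gt0// gtr0_norm.
- by rewrite scale0r resolvent_norm0 normr0 mul0r.
Qed.

End ResolventNorm.

(** * Power series bounds *)

Section CourseOfValues.
Context {T : Type}.
Variables (x0 : T) (step : nat -> (nat -> T) -> T).

(** Strong recursion: [cov_prefix n] holds the final values below [n] and the default [x0] from [n]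
    on, which [step_local] makes invisible to [step n]. *)
Fixpoint cov_prefix (n : nat) : nat -> T :=
  if n is m.+1 then fun k => if k == m then step m (cov_prefix m) else cov_prefix m k
  else fun=> x0.

Definition cov_seq n := cov_prefix n.+1 n.

Hypothesis step_local : forall n u v, (forall k, (k < n)%N -> u k = v k) ->
  step n u = step n v.

Lemma cov_seqE n : cov_seq n = step n cov_seq.
Proof.
have pE k m : (k < m)%N -> cov_prefix m k = cov_seq k.
  elim: m => // m IH; rewrite ltnS leq_eqVlt => /predU1P[->//|km] /=.
  by rewrite ltn_eqF// IH.
rewrite {1}/cov_seq/= eqxx; apply: step_local => k; exact: pE.
Qed.

End CourseOfValues.

Section Convolution.
Context {R : realType}.
Implicit Types (x y X Y b : nat -> R).

Lemma sum_triangle (G : nat -> nat -> R) N :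
  \sum_(0 <= n < N) \sum_(0 <= i < n.+1) G i (n - i)%N =
  \sum_(0 <= i < N) \sum_(0 <= k < N | (i + k < N)%N) G i k.
Proof.
rewrite (@eq_big_nat _ _ _ _ _ _
  (fun n => \sum_(0 <= i < N | (i < n.+1)%N) G i (n - i)%N)); last first.
  by move=> n /andP[_ nN]; rewrite (big_nat_widen _ _ N).
rewrite (exchange_big_dep predT)//=; apply: eq_big_nat => i /andP[_ iN].
rewrite [LHS](_ : _ = \sum_(i <= n < N) G i (n - i)%N); last first.
  rewrite [RHS](big_nat_widenl _ 0)//.
rewrite -{1}[i]add0n big_addn [LHS](big_nat_widen _ _ N) ?leq_subr//.
apply: eq_big => k; first by rewrite ltn_subRL.
by rewrite addnK.
Qed.

(** The difference consists of the products with [i + k >= N], where the factor [1 / 2 ^+ (i + k)]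
    is at most [1 / 2 ^+ N]. *)
Lemma convolution_bound x y X Y (A B : R) N :
  (forall i, `|x i| <= X i / 2 ^+ i) -> (forall i, `|y i| <= Y i / 2 ^+ i) ->
  (forall i, 0 <= X i) -> (forall i, 0 <= Y i) ->
  \sum_(0 <= i < N) X i <= A -> \sum_(0 <= i < N) Y i <= B ->
  `|(\sum_(0 <= i < N) x i) * (\sum_(0 <= i < N) y i) -
    \sum_(0 <= n < N) \sum_(0 <= i < n.+1) x i * y (n - i)%N| <= A * B / 2 ^+ N.
Proof.
move=> xX yY X0 Y0 XA YB.
rewrite (sum_triangle (fun i k => x i * y k)) mulr_suml -sumrB.
apply: (@le_trans _ _ (\sum_(0 <= i < N) \sum_(0 <= k < N) X i * Y k / 2 ^+ N)).
  rewrite (le_trans (ler_norm_sum _ _ _))// ler_sum// => i _.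
  rewrite mulr_sumr [X in X - _](bigID (fun k => (i + k < N)%N))/= addrAC subrr add0r.
  rewrite (le_trans (ler_norm_sum _ _ _))// big_mkcond/= ler_sum// => k _.
  case: ifPn => [|_]; last by rewrite divr_ge0 ?exprn_ge0// mulr_ge0.
  rewrite -leqNgt => Nik; rewrite normrM.
  apply: (@le_trans _ _ (X i * Y k / 2 ^+ (i + k))).
    rewrite exprD invfM mulrACA ler_pM//.
  rewrite ler_wpM2l ?mulr_ge0// lef_pV2 ?posrE ?exprn_gt0//.
  by rewrite ler_weXn2l// ler1n.
rewrite (eq_bigr (fun i => X i * (\sum_(0 <= k < N) Y k) / 2 ^+ N)); last first.
  by move=> i _; rewrite mulr_sumr mulr_suml.
by rewrite -!mulr_suml ler_pM2r ?invr_gt0 ?exprn_gt0// ler_pM// sumr_ge0.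
Qed.

Lemma sum_inner_convolution_le b N : (forall n, 0 <= b n) ->
  \sum_(0 <= n < N.+1) \sum_(1 <= i < n) b i * b (n - i)%N <=
  (\sum_(1 <= n < N) b n) ^+ 2.
Proof.
move=> b0; pose c n := if (0 < n < N)%N then b n else 0.
(* With [b] cut off to the indices [0 < n < N], the inner convolution becomes a full one, and its
   triangle of products lies in the square of the sum. *)
have c0 n : 0 <= c n by rewrite /c; case: ifP.
have cE n : (n < N.+1)%N ->
    \sum_(1 <= i < n) b i * b (n - i)%N = \sum_(0 <= i < n.+1) c i * c (n - i)%N.
  case: n => [|n] nN.
    by rewrite big_geq// big_nat1 /c/= mul0r.
  rewrite [RHS]big_nat_recr//= subnn [c 0%N]/c/= mulr0 addr0 [RHS]big_ltn// [c 0%N]/c/= mul0r add0r.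
  apply: eq_big_nat => i /andP[i0 iN].
  have iN' : (i < N)%N by apply: leq_trans iN nN.
  have niN : (n.+1 - i < N)%N by apply: (@leq_trans n.+1) => //; rewrite ltn_subrL i0.
  by rewrite /c i0 iN' subn_gt0 iN niN.
rewrite (eq_big_nat _ _ (F2 := fun n => \sum_(0 <= i < n.+1) c i * c (n - i)%N)); last first.
  by move=> n /andP[_ /cE].
rewrite (sum_triangle (fun i k => c i * c k)).
have -> : \sum_(1 <= n < N) b n = \sum_(0 <= n < N.+1) c n.
  rewrite [RHS]big_ltn// [c 0%N]/c/= add0r; case: N @c c0 cE => [|N] c c0 cE.
    by rewrite !big_geq.
  rewrite [RHS]big_nat_recr//= [c N.+1]/c ltnn andbF addr0.
  by apply: eq_big_nat => i iN; rewrite /c iN.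
rewrite expr2 mulr_suml ler_sum// => i _; rewrite mulr_sumr big_mkcond ler_sum//= => k _.
by case: ifP => // _; rewrite mulr_ge0.
Qed.

(** The partial sums [S] of the tail satisfy [S' <= D * (t * (b 0 + S) + S ^+ 2)], where [S'] has
    one more term. Here [D * tau ^+ 2 = tau / 4], and [t] is chosen so that
    [D * t * (b 0 + tau) = tau / 2]; hence [S <= tau] propagates. *)
Lemma quadratic_majorant b (D : R) : 0 < D -> 0 <= b 0%N ->
  (forall n, b n.+1 = D * (b n + \sum_(1 <= i < n.+1) b i * b (n.+1 - i)%N)) ->
  let tau := (4 * D)^-1 in let t := tau / (2 * D * (b 0%N + tau)) in
  (forall n, 0 <= b n) /\
  forall N, \sum_(1 <= n < N) b n * t ^+ n <= tau.
Proof.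
move=> D0 b0 bS tau t.
have tau0 : 0 < tau by rewrite invr_gt0 mulr_gt0.
have bt0 : 0 < b 0%N + tau by rewrite ltr_wpDl.
have t0 : 0 < t by rewrite divr_gt0// !mulr_gt0.
have b_ge0 n : 0 <= b n.
  elim/ltn_ind: n => -[//|n] IH; rewrite bS mulr_ge0// ?(ltW D0)//.
  rewrite addr_ge0 ?IH// big_nat sumr_ge0// => i /andP[i0 iN].
  by rewrite mulr_ge0 ?IH// ltn_subrL i0.
split => //; elim => [|[|N] IH]; first by rewrite big_geq// ltW.
  by rewrite big_geq// ltW.
pose c n := b n * t ^+ n.
have c0 n : 0 <= c n by rewrite mulr_ge0// exprn_ge0// ltW.
pose S := \sum_(1 <= n < N.+1) c n.
have S0 : 0 <= S by rewrite sumr_ge0.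
have SE : \sum_(0 <= n < N.+1) c n = b 0%N + S by rewrite big_ltn// {1}/c expr0 mulr1.
have -> : \sum_(1 <= n < N.+2) b n * t ^+ n =
   D * (t * (b 0%N + S) + \sum_(0 <= n < N.+1) \sum_(1 <= i < n.+1) c i * c (n.+1 - i)%N).
  rewrite big_add1/= -SE mulr_sumr -big_split/= mulr_sumr; apply: eq_big_nat => n _.
  rewrite bS -mulrA; congr (D * _); rewrite mulrDl; congr (_ + _).
    by rewrite /c exprS mulrCA.
  rewrite mulr_suml; apply: eq_big_nat => i /andP[i0 iN].
  by rewrite /c mulrACA -exprD subnKC// ltnW.
have le2 : \sum_(0 <= n < N.+1) \sum_(1 <= i < n.+1) c i * c (n.+1 - i)%N <= S ^+ 2.
  have := @sum_inner_convolution_le c N.+1 c0.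
  by rewrite big_ltn// [X in X + _]big_geq// add0r big_add1/=.
have Dt : D * (t * (b 0%N + tau)) = tau / 2 by rewrite /t; field; rewrite !gt_eqF.
have Dtau : D * tau ^+ 2 = tau / 4 by rewrite /tau; field; rewrite gt_eqF.
have h1 : D * (t * (b 0%N + S)) <= tau / 2 by rewrite -Dt !ler_pM2l// lerD2l.
have h2 : D * S ^+ 2 <= tau / 4 by rewrite -Dtau ler_pM2l// ler_sqr ?nnegrE// ltW.
rewrite mulrDr; apply: le_trans (lerD h1 (ler_wpM2l (ltW D0) le2)) _; lra.
Qed.

End Convolution.

(** * Analyticity of the gauge *)

Section GaugeExpansion.
Context {R : realType} {V : normedModType R} {I : Type}.
Variables (E : (I -> R) -> R) (f : I -> V -> R).
Hypothesis hE : is_mean E.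
Hypothesis f_lin : forall i, linear (f i : V -> R^o).
Hypothesis f_le : forall i x, `|f i x| <= `|x|.
Variables (a : V) (rho0 d : R).
Hypothesis d_gt0 : 0 < d.
Hypothesis a_dom : forall i, d <= rho0 - f i a.
Hypothesis a_gauge : E (resolvent f a rho0) = 2.

Let K i := (rho0 - f i a)^-1.

Let den_gt0 i : 0 < rho0 - f i a.
Proof. exact: lt_le_trans (a_dom i). Qed.

Let K_gt0 i : 0 < K i.
Proof. by rewrite invr_gt0. Qed.

Let K_le i : `|K i| <= d^-1.
Proof. by rewrite gtr0_norm// lef_pV2// posrE. Qed.

Let K_bfun : bfun K.
Proof. by exists d^-1. Qed.

Let K2_bfun : bfun (fun i => K i ^+ 2).
Proof. by apply: bfunM. Qed.

Let EK : rho0 * E K = 2.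
Proof. by rewrite -(meanZ hE). Qed.

Let rho0_gt0 : 0 < rho0.
Proof.
have : 0 < rho0 * E K by rewrite EK.
have : 0 <= E K by apply: (mean_ge0 hE) => // i; exact: ltW.
by rewrite le_eqVlt => /predU1P[<-|/pmulr_lgt0->//]; rewrite mulr0 ltxx.
Qed.

(** Minus the derivative of [rho * E (1 / (rho - f i a))] with respect to [rho] at [rho0]. *)
Let kappa := rho0 * E (fun i => K i ^+ 2) - E K.

(* The transversality condition behind the implicit function argument,
   from [0 <= E ((rho0 * K - 2) ^+ 2)]. *)
Let kappa_gt0 : 0 < kappa.
Proof.
have : 0 <= E (fun i => (rho0 ^+ 2 * K i ^+ 2 + (- 4 * rho0) * K i) + 4).
  apply: (mean_ge0 hE).
    apply: bfunD; last exact: bfun_cst.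
    by apply: bfunD; apply: bfunM => //; exact: bfun_cst.
  move=> i; have -> : rho0 ^+ 2 * K i ^+ 2 + -4 * rho0 * K i + 4 = (rho0 * K i - 2) ^+ 2 by ring.
  exact: sqr_ge0.
have bZ c (g : I -> R) : bfun g -> bfun (fun i => c * g i).
  by apply: bfunM; exact: bfun_cst.
rewrite !(meanD hE, meanZ hE, mean_cst hE) //; last 4 first.
- exact: bZ.
- exact: bZ.
- by apply: bfunD; exact: bZ.
- exact: bfun_cst.
rewrite (_ : -4 * rho0 * E (fun i => K i) = -4 * 2); last by rewrite -EK mulrA.
move=> h.
rewrite -(pmulr_rgt0 _ rho0_gt0) /kappa mulrBr EK mulrA -expr2; lra.
Qed.

(** The degree-[n] part of the resolvent equation reads [psi_n = m - r_n * K ^+ 2] with [m] made of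
    lower degrees; inserted into the gauge equation it leaves [kappa * r_n] equal to known terms.
    The two sequences are generated together as a pair. *)
Let gen_step n (u : nat -> V -> (I -> R) * R) x : (I -> R) * R :=
  if n is n'.+1 then
    let m i := K i * ((u n' x).1 i * f i x
                      - \sum_(1 <= j < n) (u j x).2 * (u (n - j)%N x).1 i) in
    let r := kappa^-1 * (rho0 * E m
                      + \sum_(1 <= j < n) (u j x).2 * E (u (n - j)%N x).1) in
    (fun i => m i - r * K i ^+ 2, r)
  else (K, rho0).

(* [psi n] and [r n] are the degree-[n] parts at [a] of the resolvent
   [1 / (rho - f i)] and of the gauge [rho]: they solve
   [psi * (rho - f i) = 1] and [rho * E psi = 2] degree by degree. *)
Let u := cov_seq (fun _ => (K, rho0)) gen_step.
Let psi n i x := (u n x).1 i.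
Let r n x := (u n x).2.
Let conv n i x := \sum_(1 <= j < n) r j x * psi (n - j) i x.
Let econv n x := \sum_(1 <= j < n) r j x * E (psi (n - j) ^~ x).
Let m n i x := K i * (psi n i x * f i x - conv n.+1 i x).

Let uE n : u n = gen_step n u.
Proof.
apply: cov_seqE => {}n v w vw; apply/funext => x; rewrite /gen_step.
case: n vw => // n vw.
have e1 i : \sum_(1 <= j < n.+1) (v j x).2 * (v (n.+1 - j)%N x).1 i =
            \sum_(1 <= j < n.+1) (w j x).2 * (w (n.+1 - j)%N x).1 i.
  apply: eq_big_nat => j /andP[j0 jn]; rewrite !vw//.
  by rewrite ltn_subrL j0.
have e2 : \sum_(1 <= j < n.+1) (v j x).2 * E (v (n.+1 - j)%N x).1 =
          \sum_(1 <= j < n.+1) (w j x).2 * E (w (n.+1 - j)%N x).1.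
  apply: eq_big_nat => j /andP[j0 jn]; rewrite !vw//.
  by rewrite ltn_subrL j0.
have e3 : (fun i => K i * ((v n x).1 i * f i x
    - \sum_(1 <= j < n.+1) (v j x).2 * (v (n.+1 - j)%N x).1 i)) =
  (fun i => K i * ((w n x).1 i * f i x
    - \sum_(1 <= j < n.+1) (w j x).2 * (w (n.+1 - j)%N x).1 i)).
  by apply/funext => i; rewrite e1 vw.
rewrite /= e3 e2; congr pair; apply/funext => i.
by rewrite e1 vw.
Qed.

Let psi0 i x : psi 0 i x = K i. Proof. by rewrite /psi uE. Qed.
Let r0 x : r 0 x = rho0. Proof. by rewrite /r uE. Qed.
Let rS n x : r n.+1 x = kappa^-1 * (rho0 * E (m n ^~ x) + econv n.+1 x).
Proof. by rewrite /r uE. Qed.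
Let psiS n i x : psi n.+1 i x = m n i x - r n.+1 x * K i ^+ 2.
Proof. by rewrite rS /psi uE. Qed.

(** [k0] bounds [K], [D1] is the growth factor of [r], and [D] dominates both [D1] and the factor
    [k0 + D1 * k0 ^+ 2] of [psi]. *)
Let k0 := d^-1.
Let k0_gt0 : 0 < k0. Proof. by rewrite invr_gt0. Qed.
Let D1 := kappa^-1 * (rho0 * k0 + 1).
Let D := k0 + (D1 * k0 ^+ 2 + D1).
Let D1_gt0 : 0 < D1.
Proof. by rewrite mulr_gt0 ?invr_gt0// addr_gt0// mulr_gt0. Qed.
Let D_gt0 : 0 < D.
Proof. by rewrite !addr_gt0// mulr_gt0// exprn_gt0. Qed.

Let b := cov_seq 0 (fun n (b : nat -> R) => if n is n'.+1 then
  D * (b n' + \sum_(1 <= i < n) b i * b (n - i)%N) else k0).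

Let bE n : b n = if n is n'.+1 then
  D * (b n' + \sum_(1 <= i < n) b i * b (n - i)%N) else k0.
Proof.
rewrite {1}/b cov_seqE// => {}n v w vw; case: n vw => // n vw.
rewrite vw//; congr (_ * (_ + _)); apply: eq_big_nat => j /andP[j0 jn].
by rewrite !vw// ltn_subrL j0.
Qed.

Let tau := (4 * D)^-1.
Let t := tau / (2 * D * (k0 + tau)).

Let b_major : (forall n, 0 <= b n) /\ forall N, \sum_(1 <= n < N) b n * t ^+ n <= tau.
Proof.
have := @quadratic_majorant R b D D_gt0; rewrite [b 0%N]bE; apply; first exact: ltW.
by move=> n; rewrite bE.
Qed.

Let b_ge0 n : 0 <= b n. Proof. exact: b_major.1. Qed.

(** The bounds follow the recursion term by term. [b 0] is the bound of [psi 0] only, hence the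
    condition [0 < n] for [r]; the convolutions involve [r j] with [j >= 1] alone. *)
Let psi_r_bpoly n : bpoly n (b n) (psi n) /\ ((0 < n)%N -> bpoly n (b n) (fun _ : I => r n)).
Proof.
elim/ltn_ind: n => -[|n] IH.
  split => //; rewrite bE; apply: (@bpoly_ext _ _ _ _ _ (fun i _ => K i)).
    by move=> i x; rewrite psi0.
  exact: bpoly_cst.
pose sg := \sum_(1 <= i < n.+1) b i * b (n.+1 - i)%N.
have sg0 : 0 <= sg by rewrite sumr_ge0// => i _; rewrite mulr_ge0.
have convP : bpoly n.+1 sg (conv n.+1).
  rewrite /sg big_nat; apply: (@bpoly_ext _ _ _ _ _ (fun i x =>
    \sum_(1 <= j < n.+1 | (1 <= j < n.+1)%N) r j x * psi (n.+1 - j) i x)).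
    by move=> i x; rewrite /conv [RHS]big_nat.
  apply: bpoly_sum => j /andP[j0 jn]; apply: (@bpolyM _ _ _ j (n.+1 - j)) => //.
  - by rewrite subnKC// ltnW.
  - exact: (IH j jn).2.
  - by apply: (IH _ _).1; rewrite ltn_subrL j0.
have econvP : bpoly n.+1 sg (fun _ : I => econv n.+1).
  rewrite /sg big_nat; apply: (@bpoly_ext _ _ _ _ _ (fun i x =>
    \sum_(1 <= j < n.+1 | (1 <= j < n.+1)%N) r j x * E (psi (n.+1 - j) ^~ x))).
    by move=> i x; rewrite /econv [RHS]big_nat.
  apply: bpoly_sum => j /andP[j0 jn]; apply: (@bpolyM _ _ _ j (n.+1 - j)) => //.
  - by rewrite subnKC// ltnW.
  - exact: (IH j jn).2.
  - by apply: bpoly_mean => //; apply: (IH _ _).1; rewrite ltn_subrL j0.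
have mP : bpoly n.+1 (k0 * (b n + sg)) (m n).
  apply: (@bpolyM _ _ _ 0 n.+1) => //; [exact: ltW|exact: bpoly_cst|].
  apply: bpolyD; last exact: bpolyN.
  rewrite -[b n]mulr1; apply: (@bpolyM _ _ _ n 1) => //; first by rewrite addn1.
    exact: (IH n _).1.
  by apply: bpoly_lin => // i x; rewrite mul1r.
have rP : bpoly n.+1 (D1 * (b n + sg)) (fun _ : I => r n.+1).
  apply: (@bpoly_ext _ _ _ _ _ (fun _ x =>
    kappa^-1 * (rho0 * E (m n ^~ x) + econv n.+1 x))); first by move=> _ x; rewrite rS.
  apply: (@bpoly_le _ _ _ _ (kappa^-1 * (rho0 * (k0 * (b n + sg)) + sg))).
    rewrite /D1 -mulrA ler_pM2l ?invr_gt0//.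
    by rewrite mulrDl mulrA lerD2l mul1r lerDr.
  apply: (@bpolyM _ _ _ 0 n.+1) => //; first by rewrite invr_ge0 ltW.
    by apply: bpoly_cst => _; rewrite gtr0_norm// invr_gt0.
  apply: bpolyD => //; apply: (@bpolyM _ _ _ 0 n.+1) => //; first exact: ltW.
    by apply: bpoly_cst => _; rewrite gtr0_norm.
  exact: bpoly_mean.
have bnE : b n.+1 = D * (b n + sg) by rewrite bE.
have bsg0 : 0 <= b n + sg by rewrite addr_ge0.
split=> [|_]; last first.
  apply: bpoly_le rP; rewrite bnE ler_wpM2r// /D addrA lerDr addr_ge0//; first exact: ltW.
  by rewrite mulr_ge0 ?exprn_ge0// ltW.
apply: (@bpoly_ext _ _ _ _ _ (fun i x => m n i x + - (r n.+1 x * K i ^+ 2))).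
  by move=> i x; rewrite psiS.
apply: (@bpoly_le _ _ _ _ (k0 * (b n + sg) + D1 * (b n + sg) * k0 ^+ 2)).
  rewrite bnE /D mulrDl lerD2l mulrAC ler_wpM2r// lerDl.
  exact: ltW.
apply: bpolyD => //; apply: bpolyN; apply: (@bpolyM _ _ _ n.+1 0) => //.
- by rewrite addn0.
- by rewrite mulr_ge0// ltW.
- by apply: bpoly_cst => i; rewrite normrX ler_pXn2r ?nnegrE// ltW.
Qed.

Let psi_bfun n x : bfun (psi n ^~ x).
Proof.
exists (b n * `|x| ^+ n) => i.
exact: (bpoly_bound i x (psi_r_bpoly n).1).
Qed.

Let tau_gt0 : 0 < tau. Proof. by rewrite invr_gt0 mulr_gt0. Qed.

Let t_gt0 : 0 < t.
Proof. by rewrite divr_gt0// !mulr_gt0// addr_gt0. Qed.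

Let k0D : k0 <= D.
Proof. by rewrite lerDl ltW// addr_gt0// mulr_gt0// exprn_gt0. Qed.

Let Dinv_le : D^-1 <= d.
Proof. by rewrite -[leRHS]invrK lef_pV2// posrE// invr_gt0. Qed.

(** Together with [t_le] this preserves half of the gap [d]: the radius moves by at most [tau] and
    [f i h] is at most [t / 2], so each costs at most [d / 4]. *)
Let tau_le : tau <= d / 4.
Proof. by rewrite /tau invfM mulrC ler_pM2r. Qed.

Let t_le : t <= d / 2.
Proof.
apply: (@le_trans _ _ (D^-1 / 2)); last by rewrite ler_pM2r.
rewrite /t ler_pdivrMr; last by rewrite !mulr_gt0// addr_gt0.
have -> : D^-1 / 2 * (2 * D * (k0 + tau)) = k0 + tau by field; rewrite gt_eqF.
by rewrite lerDr ltW.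
Qed.

(** On an empty [I] the resolvent would be the zero function, of mean [0] and not [2]. An index
    serves to read off the bound of [r], kept as a constant family over [I]. *)
Let I_inhabited : exists i : I, True.
Proof.
apply: contrapT => noI; have := a_gauge.
rewrite (_ : resolvent f a rho0 = fun=> 0) ?(mean_cst hE).
  by move/eqP; rewrite eq_sym pnatr_eq0.
by apply/funext => i; exfalso; apply: noI; exists i.
Qed.

Section Direction.
Variable h : V.
Hypothesis h_lt : `|h| < t / 2.

(** Since [h] has norm below [t / 2], the degree-[n] terms are at most [X n / 2 ^+ n], the form that
    [convolution_bound] takes. *)
Let X n := b n * t ^+ n.
Let X_ge0 n : 0 <= X n. Proof. by rewrite mulr_ge0// exprn_ge0// ltW. Qed.

Let h_exp n : `|h| ^+ n <= t ^+ n / 2 ^+ n.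
Proof. by rewrite -expr_div_n; apply: lerXn2r; rewrite ?nnegrE// ltW// divr_gt0. Qed.

Let psi_le n i : `|psi n i h| <= X n / 2 ^+ n.
Proof.
rewrite (le_trans (bpoly_bound i h (psi_r_bpoly n).1))// /X -mulrA.
by rewrite ler_wpM2l.
Qed.

Let Xr n := if n == 0%N then rho0 else X n.
Let Xr_ge0 n : 0 <= Xr n.
Proof. by rewrite /Xr; case: ifP => // _; exact: ltW. Qed.

Let r_le n : `|r n h| <= Xr n / 2 ^+ n.
Proof.
rewrite /Xr; case: n => [|n] /=; first by rewrite r0 expr0 divr1 gtr0_norm.
have [i _] := I_inhabited.
rewrite (le_trans (bpoly_bound i h ((psi_r_bpoly n.+1).2 isT)))// /X -mulrA.
by rewrite ler_wpM2l.
Qed.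

(** [y i n] is the degree-[n] part at [h] of [rho - f i (a + h)], with [f i a] in degree 0 and
    [f i h] in degree 1; [Y n / 2 ^+ n] majorizes it. *)
Let Y n := (if n == 0%N then rho0 + `|a| else X n) + (if n == 1%N then t else 0).
Let y i n := (if n == 0%N then rho0 - f i a else r n h) - (if n == 1%N then f i h else 0).

Let Y_ge0 n : 0 <= Y n.
Proof.
by rewrite /Y addr_ge0//; case: ifP => // _; rewrite ?addr_ge0// ltW.
Qed.

Let y_le i n : `|y i n| <= Y n / 2 ^+ n.
Proof.
rewrite /y /Y mulrDl (le_trans (ler_normB _ _))// lerD//.
  case: n => [|n] /=; last by have := r_le n.+1; rewrite /Xr.
  rewrite expr0 divr1 (le_trans (ler_normB _ _))// gtr0_norm// lerD2l//.
case: n => [|[|n]] /=; rewrite ?normr0 ?mul0r// expr1 (le_trans (f_le _ _))//.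
exact: ltW.
Qed.

Let X_sum N : \sum_(0 <= n < N) X n <= k0 + tau.
Proof.
case: N => [|N]; first by rewrite big_geq// addr_ge0// ltW.
by rewrite big_ltn// {1}/X expr0 mulr1 [b 0%N]bE lerD2l b_major.2.
Qed.

Let Xr_sum N : \sum_(0 <= n < N) Xr n <= rho0 + tau.
Proof.
case: N => [|N]; first by rewrite big_geq// addr_ge0// ltW.
rewrite big_ltn// {1}/Xr lerD2l.
rewrite (eq_big_nat _ _ (F2 := X)); first exact: b_major.2.
by move=> i /andP[i0 _]; rewrite /Xr gtn_eqF.
Qed.

Let Y_sum N : \sum_(0 <= n < N) Y n <= rho0 + `|a| + tau + t.
Proof.
rewrite /Y big_split/= lerD//.
  case: N => [|N]; first by rewrite big_geq// !addr_ge0// ltW.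
  rewrite big_ltn//= lerD2l.
  rewrite (eq_big_nat _ _ (F2 := X)); first exact: b_major.2.
  by move=> i /andP[i0 _]; rewrite gtn_eqF.
case: N => [|[|N]]; first by rewrite big_geq// ltW.
  by rewrite big_nat1/= ltW.
rewrite big_ltn// big_ltn//= add0r big_nat big1 ?addr0// => i /andP[i0 _].
by rewrite gtn_eqF.
Qed.

Let Psi N i := \sum_(0 <= n < N) psi n i h.
Let Rho N := \sum_(0 <= n < N) r n h.

Let y_sum i N : (1 < N)%N -> \sum_(0 <= n < N) y i n = Rho N - f i (a + h).
Proof.
case: N => [|[|N]] // _; rewrite /Rho big_ltn// big_ltn// [in RHS]big_ltn// [in RHS]big_ltn//.
rewrite /y/= r0 subr0 (eq_big_nat _ _ (F2 := fun n => r n h)); last first.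
  by move=> n /andP[n1 _]; rewrite gtn_eqF ?gtn_eqF ?subr0// ltnW.
have := f_lin i 1 a h; rewrite !scale1r => ->.
by rewrite opprD; ring.
Qed.

(** The recursion for [psi], read as a Cauchy product: the two formal series are inverse to each
    other. *)
Let y_psi i n : \sum_(0 <= j < n.+1) y i j * psi (n - j) i h = (n == 0%N)%:R.
Proof.
case: n => [|n].
  by rewrite big_nat1 /y/= psi0 subr0 divff// gt_eqF.
rewrite big_ltn// {1}/y/= subr0 subn0.
have -> : \sum_(1 <= j < n.+2) y i j * psi (n.+1 - j) i h =
    \sum_(1 <= j < n.+2) r j h * psi (n.+1 - j) i h - f i h * psi n i h.
  rewrite big_ltn// [in RHS]big_ltn// {1}/y/= subSS subn0.
  rewrite (eq_big_nat _ _ (F2 := fun j => r j h * psi (n.+1 - j) i h)); last first.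
    by move=> j /andP[j1 _]; rewrite /y gtn_eqF ?gtn_eqF ?subr0// ltnW.
  by ring.
rewrite big_nat_recr//= subnn psi0 -/(conv n.+1 i h) psiS /m.
by rewrite /K; field; rewrite gt_eqF.
Qed.

Let C1 := (rho0 + `|a| + tau + t) * (k0 + tau).

(** Partial sums solve the resolvent equation up to an error of order [2 ^- N], uniformly in [i];
    [1 < N] ensures that the term [f i h] of degree 1 is included. *)
Let Psi_approx N i : (1 < N)%N -> `|Psi N i * (Rho N - f i (a + h)) - 1| <= C1 / 2 ^+ N.
Proof.
move=> N1; rewrite -y_sum// mulrC.
have one : \sum_(0 <= n < N) \sum_(0 <= j < n.+1) y i j * psi (n - j) i h = 1.
  rewrite (eq_bigr _ (fun n _ => y_psi i n)) big_ltn ?(ltn_trans _ N1)//.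
  by rewrite big_nat big1 ?addr0// => n /andP[n0 _]; rewrite gtn_eqF.
rewrite -[X in _ - X]one; apply: convolution_bound => //; exact: X_sum.
Qed.

Let EPsi N := \sum_(0 <= n < N) E (psi n ^~ h).

Let EPsiE N : EPsi N = E (Psi N).
Proof.
rewrite /EPsi /Psi; elim: N => [|N IH].
  by rewrite big_geq// -[LHS](mean_cst hE); congr E; apply/funext => i; rewrite big_geq.
rewrite big_nat_recr//= IH -(meanD hE)//.
  by congr E; apply/funext => i; rewrite big_nat_recr.
exists (k0 + tau) => i; rewrite (le_trans (ler_norm_sum _ _ _))//.
rewrite (le_trans _ (X_sum N))// ler_sum// => n _.
by rewrite (le_trans (psi_le _ _))// ler_pdivrMr ?exprn_gt0// ler_peMr// -natrX ler1n expn_gt0.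
Qed.

Let r_Epsi n : \sum_(0 <= j < n.+1) r j h * E (psi (n - j) ^~ h) = 2 * (n == 0%N)%:R.
Proof.
have psi0K : psi 0 ^~ h = K by apply/funext => i; exact: psi0.
case: n => [|n]; first by rewrite big_nat1 r0 subn0 psi0K EK mulr1.
rewrite big_ltn// r0 subn0 big_nat_recr//= subnn -/(econv n.+1 h) psi0K.
have -> : E (psi n.+1 ^~ h) = E (m n ^~ h) - r n.+1 h * E (fun i => K i ^+ 2).
  rewrite -(meanZ hE)// -(meanB hE).
  - by congr E; apply/funext => i; rewrite psiS.
  - have [B HB] := psi_bfun n.+1 h; have [B' HB'] := K2_bfun.
    exists (B + `|r n.+1 h| * B') => i.
    rewrite -[m n i h](subrK (r n.+1 h * K i ^+ 2)) -psiS.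
    by rewrite (le_trans (ler_normD _ _))// lerD// normrM ler_wpM2l.
  - by apply: bfunM => //; exact: bfun_cst.
have : r n.+1 h * kappa = rho0 * E (m n ^~ h) + econv n.+1 h.
  by rewrite rS mulrAC mulVf ?mul1r// gt_eqF.
by rewrite mulr0 /kappa; lra.
Qed.

Let C2 := (rho0 + tau) * (k0 + tau).

Let EPsi_approx N : (0 < N)%N -> `|Rho N * EPsi N - 2| <= C2 / 2 ^+ N.
Proof.
move=> N0.
have two : \sum_(0 <= n < N) \sum_(0 <= j < n.+1) r j h * E (psi (n - j) ^~ h) = 2.
  rewrite (eq_bigr _ (fun n _ => r_Epsi n)) big_ltn//= mulr1.
  by rewrite big_nat big1 ?addr0// => n /andP[n0 _]; rewrite gtn_eqF// mulr0.
rewrite -[X in _ - X]two; apply: (@convolution_bound _ _ _ Xr X) => // n.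
exact: (mean_norm_le hE).
Qed.

Let half_le1 n (x : R) : 0 <= x -> x / 2 ^+ n <= x.
Proof. by move=> x0; rewrite ler_pdivrMr ?exprn_gt0// ler_peMr// -natrX ler1n expn_gt0. Qed.

Let Rho_dist N : (0 < N)%N -> `|Rho N - rho0| <= tau.
Proof.
case: N => // N _; rewrite /Rho big_ltn// r0 addrC addKr.
rewrite (le_trans (ler_norm_sum _ _ _))// (le_trans _ (b_major.2 N.+1))//.
rewrite big_nat [leRHS]big_nat ler_sum// => n /andP[n0 _].
rewrite (le_trans (r_le n))// /Xr gtn_eqF//; exact: half_le1.
Qed.

Let Rho_cvg : cvgn Rho.
Proof.
apply: (@normed_cvg R R^o (fun n => r n h)); apply: nondecreasing_is_cvgn.
  apply/nondecreasing_seqP => n; by rewrite /= /series/= big_nat_recr//= lerDl.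
exists (rho0 + tau) => _ [n _ <-]; rewrite /= /series/= (le_trans _ (Xr_sum n))//.
by rewrite ler_sum// => k _; rewrite (le_trans (r_le k))// half_le1.
Qed.

Let Psi_le N i : `|Psi N i| <= k0 + tau.
Proof.
rewrite (le_trans (ler_norm_sum _ _ _))// (le_trans _ (X_sum N))// ler_sum// => n _.
by rewrite (le_trans (psi_le _ _))// half_le1.
Qed.

(** [Psi N] converges to [1 / (rho - f i (a + h))] uniformly in [i], so its means converge too, and
    the approximate gauge equation passes to the limit. *)
Let gauge_lim : gauge E f (a + h) (limn Rho).
Proof.
set rho := limn Rho.
have Rrho : Rho @ \oo --> rho by exact: Rho_cvg.
have gap i : d / 2 <= rho - f i (a + h).
  have : d - d / 4 - d / 4 + f i (a + h) <= rho.
    apply: (cvgr_to_ge Rrho).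
    near=> N.
    have N0 : (0 < N)%N by near: N; exact: nbhs_infty_gt.
    have := Rho_dist N0; rewrite ler_norml => /andP[h1 _].
    have := f_le i h; rewrite ler_norml => /andP[_ h2].
    have := f_lin i 1 a h; rewrite !scale1r => ->.
    have := a_dom i; have := tau_le; have := t_le; move: h_lt h1 h2; lra.
  lra.
have dom : dominates f (a + h) rho by exists (d / 2); rewrite ?divr_gt0.
split => //.
have gap0 i : 0 < rho - f i (a + h) by apply: lt_le_trans (gap i); rewrite divr_gt0.
pose q i := (rho - f i (a + h))^-1.
have q_le i : `|q i| <= (d / 2)^-1.
  by rewrite gtr0_norm ?invr_gt0// lef_pV2// posrE// divr_gt0.
have qb : bfun q by exists (d / 2)^-1.
pose eps N := (d / 2)^-1 * ((k0 + tau) * `|rho - Rho N| + C1 / 2 ^+ N).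
have two_cvg (c : R) : (fun N => c / 2 ^+ N) @ \oo --> (0 : R).
  rewrite (_ : (fun N => c / 2 ^+ N) = geometric c 2^-1); last first.
    by apply/funext => N; rewrite /geometric/= exprVn.
  by apply: cvg_geometric; rewrite gtr0_norm ?invf_lt1 ?invr_gt0// ltr1n.
have eps_cvg : eps @ \oo --> (0 : R).
  rewrite -[0](mulr0 (d / 2)^-1); apply: cvgM; first exact: cvg_cst.
  rewrite -[0](addr0 0); apply: cvgD => //.
  rewrite -(mulr0 (k0 + tau)); apply: cvgM; first exact: cvg_cst.
  rewrite -(normr0 R) -(subrr rho); apply: cvg_norm; apply: cvgB => //; exact: cvg_cst.
have Eq_close N : (1 < N)%N -> `|EPsi N - E q| <= eps N.
  move=> N1; rewrite EPsiE -(meanB hE)//; last by exists (k0 + tau).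
  apply: (mean_norm_le hE) => i.
  (* The equation [q i * (rho - f i (a + h)) = 1] splits the error into the error of the radius and
     that of the resolvent equation. *)
  have -> : Psi N i - q i = q i * (Psi N i * (rho - Rho N)
      + (Psi N i * (Rho N - f i (a + h)) - 1)).
    by rewrite /q; field; rewrite gt_eqF.
  rewrite normrM ler_pM// (le_trans (ler_normD _ _))// lerD ?Psi_approx//.
  by rewrite normrM ler_wpM2r.
have EPsi_cvg : EPsi @ \oo --> E q.
  apply: (squeeze_cvgr (f := fun N => E q - eps N) (h := fun N => E q + eps N)).
  - near=> N; have N1 : (1 < N)%N by near: N; exact: nbhs_infty_gt.
    by rewrite -ler_distlC; rewrite distrC Eq_close.
  - by rewrite -[X in _ --> X]subr0; apply: cvgB => //; exact: cvg_cst.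
  - by rewrite -[X in _ --> X]addr0; apply: cvgD => //; exact: cvg_cst.
have lim1 : (fun N => Rho N * EPsi N) @ \oo --> rho * E q by exact: cvgM.
have lim2 : (fun N => Rho N * EPsi N) @ \oo --> (2 : R).
  apply: (squeeze_cvgr (f := fun N => 2 - C2 / 2 ^+ N) (h := fun N => 2 + C2 / 2 ^+ N)).
  - near=> N; have N1 : (0 < N)%N by near: N; exact: nbhs_infty_gt.
    by rewrite -ler_distlC; rewrite distrC EPsi_approx.
  - by rewrite -[X in _ --> X]subr0; apply: cvgB => //; exact: cvg_cst.
  - by rewrite -[X in _ --> X]addr0; apply: cvgD => //; exact: cvg_cst.
rewrite -(cvg_unique _ lim1 lim2)// -(meanZ hE)//.
Unshelve. all: by end_near.
Qed.

Lemma gauge_expansion_at : exists2 rho, series (fun n => r n h) @ \oo --> rho &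
  gauge E f (a + h) rho.
Proof. by exists (limn Rho); [exact: Rho_cvg|exact: gauge_lim]. Qed.

End Direction.

Lemma gauge_expansion : exists2 delta, 0 < delta &
  exists2 P : nat -> V -> R, (forall n, @cont_homog_poly R V R n (P n)) &
  forall h, `|h| < delta -> exists2 rho, series (fun n => P n h) @ \oo --> rho &
    gauge E f (a + h) rho.
Proof.
exists (t / 2); first by rewrite divr_gt0.
exists r; last exact: gauge_expansion_at.
have [i _] := I_inhabited.
case=> [|n].
  apply: (@bpoly_cont_homog R V I 0 rho0 (fun _ => r 0) i); first exact: ltW.
  apply: (@bpoly_ext _ _ _ _ _ (fun _ _ => rho0)); first by move=> j x; rewrite r0.
  by apply: bpoly_cst => _; rewrite gtr0_norm.
by apply: (bpoly_cont_homog i (b_ge0 n.+1)); exact: (psi_r_bpoly n.+1).2.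
Qed.

End GaugeExpansion.

(** * A weighted mean on a countable index set, and the renorming criterion *)

Section DyadicMean.
Context {R : realType}.
Implicit Types c d : nat * bool -> R.

(** Both [(n, true)] and [(n, false)] have weight [2^-1 ^+ n.+2]: the total is [1], and exchanging
    the signs preserves the mean. *)
Let term c n := 2^-1 ^+ n.+2 * (c (n, true) + c (n, false)).

Definition dyadic_mean c : R := limn (series (term c)).

Let half_geom : series (fun n => 2^-1 ^+ n.+1 : R) @ \oo --> (1 : R).
Proof.
have := @cvg_geometric_series R 2^-1 2^-1.
rewrite (_ : 2^-1 / (1 - 2^-1) = 1 :> R); last by field.
rewrite (_ : geometric _ _ = (fun n => 2^-1 ^+ n.+1)); last first.
  by apply/funext => n; rewrite /geometric/= exprS.
by apply; rewrite gtr0_norm ?invf_lt1 ?invr_gt0// ltr1n.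
Qed.

Let p0 n : 0 <= 2^-1 ^+ n :> R.
Proof. by rewrite exprn_ge0// invr_ge0. Qed.

Let term_cvg c : bfun c -> cvgn (series (term c)).
Proof.
move=> [M cM]; apply: (@normed_cvg R R^o); apply: (@series_le_cvg R _ (M *: (fun n => 2^-1 ^+ n.+1))).
- by move=> n /=.
- move=> n; rewrite mulr_ge0//; exact: le_trans (cM (n, true)).
- move=> n /=; rewrite normrM ger0_norm// exprS -mulrA mulrCA [leRHS]mulrC ler_wpM2l//.
  rewrite ler_pdivrMl// (le_trans (ler_normD _ _))//.
  have := cM (n, true); have := cM (n, false); lra.
- apply: is_cvg_seriesZ; apply: cvgP; exact: half_geom.
Qed.

Lemma dyadic_mean_is_mean : is_mean dyadic_mean.
Proof.
have lin a c d : bfun c -> bfun d ->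
    dyadic_mean (fun i => a * c i + d i) = a * dyadic_mean c + dyadic_mean d.
  move=> bc bd; rewrite /dyadic_mean.
  rewrite (_ : term _ = a *: term c + term d); last first.
    by apply/funext => n; rewrite /term !fctE/= /GRing.scale/=; ring.
  have cc : cvgn (series (a *: term c)) by apply: is_cvg_seriesZ; exact: term_cvg.
  rewrite lim_seriesD//; last exact: term_cvg.
  by rewrite lim_seriesZ//; exact: term_cvg.
have pos c n : bfun c -> (forall i, 0 <= c i) -> term c n <= dyadic_mean c.
  move=> bc c0; have t0 k : 0 <= term c k by rewrite mulr_ge0// addr_ge0.
  apply: (@le_trans _ _ (series (term c) n.+1)).
    by rewrite /series/= big_nat_recr//= lerDr sumr_ge0.
  apply: nondecreasing_cvgn_le; last exact: term_cvg.
  by apply/nondecreasing_seqP => k; rewrite /series/= big_nat_recr//= lerDl.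
split => //.
- move=> c bc c0; apply: le_trans (pos c 0 bc c0).
  by rewrite mulr_ge0// addr_ge0.
- apply/cvg_lim => //; rewrite (_ : term _ = fun n => 2^-1 ^+ n.+1)//.
  by apply/funext => n; rewrite /term exprS; field.
- case=> n e; exists (2^-1 ^+ n.+2); first by rewrite exprn_gt0// invr_gt0.
  move=> c bc c0; apply: le_trans (pos c n bc c0); rewrite /term ler_wpM2l//.
  by case: e; rewrite ?lerDl ?lerDr.
Qed.

Definition flip (i : nat * bool) := (i.1, ~~ i.2).

Lemma dyadic_mean_flip c : dyadic_mean (c \o flip) = dyadic_mean c.
Proof.
rewrite /dyadic_mean (_ : term (c \o flip) = term c)//.
by apply/funext => n; rewrite /term/= addrC.
Qed.

End DyadicMean.

(** The functionals are doubled to a family closed under negation, the boolean being the sign; the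
    resolvent norm then lies between their maximum and twice that maximum. *)
Lemma analytic_renorming_of_attained_sup (R : realType) (Y : normedModType R)
    (g : nat -> Y -> R) (c C : R) :
  0 < c -> (forall n, linear (g n : Y -> R^o)) ->
  (forall n y, `|g n y| <= C * `|y|) ->
  (forall y, exists n, (forall m, `|g m y| <= `|g n y|) /\ c * `|y| <= `|g n y|) ->
  admits_equivalent_analytic_norm Y.
Proof.
move=> c0 glin gC gmax.
pose f (i : nat * bool) y := if i.2 then - g i.1 y else g i.1 y.
have f_lin i : linear (f i : Y -> R^o).
  move=> l x y; rewrite /f; case: i.2; rewrite glin//.
  by rewrite opprD scalerN.
have f_sym i y : f (flip i) y = - f i y.
  by rewrite /f/flip/=; case: i.2; rewrite ?opprK.
have f_abs i y : `|f i y| = `|g i.1 y| by rewrite /f; case: i.2; rewrite ?normrN.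
have f_max y : exists i, forall j, f j y <= f i y.
  have [n [gn _]] := gmax y.
  have [g0|g0] := leP 0 (g n y).
    exists (n, false) => j; rewrite (le_trans (ler_norm _))// f_abs (le_trans (gn _))//.
    by rewrite ger0_norm.
  exists (n, true) => j; rewrite (le_trans (ler_norm _))// f_abs (le_trans (gn _))//.
  by rewrite ltr0_norm.
have f_sep y : (forall i, f i y = 0) -> y = 0.
  move=> fy0; have [n [_]] := gmax y; have := fy0 (n, false); rewrite /f/= => ->.
  by rewrite normr0 pmulr_rle0// normr_le0 => /eqP.
have hE := @dyadic_mean_is_mean R.
pose E := @dyadic_mean R.
have Esym (w : nat * bool -> R) : bfun w -> E (w \o flip) = E w.
  by move=> _; exact: dyadic_mean_flip.
pose nu0 := resolvent_norm E f.
have nuD x y : nu0 (x + y) <= nu0 x + nu0 y by exact: resolvent_normD.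
have nuZ l x : nu0 (l *: x) = `|l| * nu0 x by exact: (resolvent_normZ hE Esym f_lin f_sym f_max f_sep).
have nu_eq0 x : nu0 x = 0 -> x = 0 by exact: (resolvent_norm_eq0 hE f_sym f_max f_sep).
pose nu := NormOn nuD nuZ nu_eq0.
exists nu; split.
  exists c, (2 * Num.max C 1); split => //; first by rewrite mulr_gt0// lt_max ltr01 orbT.
  move=> y; apply/andP; split.
    have [n [_ cn]] := gmax y; rewrite (le_trans cn)//.
    exact: (resolvent_norm_ge hE f_lin f_sym f_max f_sep y (n, false)).
  rewrite -mulrA; apply: (resolvent_norm_le hE f_lin f_sym f_max f_sep) => i.
  rewrite (le_trans (ler_norm _))// f_abs (le_trans (gC _ _))// ler_wpM2r//.
  by rewrite le_max lexx.
move=> a; set aa := (a : renormed nu) => a0.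
have nua : gauge E f a (nu a) := resolvent_normP hE f_sym f_max f_sep a0.
have nua0 : 0 < nu a := resolvent_norm_gt0 hE f_sym f_max f_sep a0.
have [[d d0 Hd] E2] := nua.
(* The expansion is taken in the new norm, for which every [f i] has norm at most [1]. *)
have [delta delta0 [P Phom HP]] := @gauge_expansion R (renormed nu) _ E f hE f_lin
  (fun i x => resolvent_norm_ge hE f_lin f_sym f_max f_sep x i) a (nu a) d d0 Hd E2.
(* A radius of at most [nu a] keeps [0] out of the open ball. *)
exists (Num.min delta (nu a)); first by rewrite lt_min delta0.
split.
  move=> x; rewrite -ball_normE/= lt_min => /andP[_].
  by apply: contraTneq => ->; rewrite subr0 ltxx.
exists P => // x; rewrite -ball_normE/= lt_min distrC => /andP[xd _].
have [rho cvg_rho] := HP _ xd.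
rewrite subrKC => /(resolvent_norm_uniq hE f_lin f_sym f_max f_sep) rhoE.
by rewrite -rhoE in cvg_rho.
Qed.

(** * The space ell_infty *)

Section DenseAnalytic.
Context {R : realType}.

Lemma dense_ball (X : normedModType R) (P : set X) :
  (forall x (e : R), 0 < e -> exists2 y, P y & `|x - y| <= e) -> dense P.
Proof.
move=> HP U [x Ux] oU.
have /nbhs_ballP[e /= e0 xU] : nbhs x U by exact: open_nbhs_nbhs.
have [|y Py xy] := HP x (e / 2); first by rewrite divr_gt0.
exists y; split => //; apply: xU; rewrite -ball_normE/=.
by rewrite (le_lt_trans xy)// ltr_pdivrMr// ltr_pMr// ltr1n.
Qed.

(** The [g n] are functions on all of [X] whose linearity and bounds are asked on [P] only, so they
    may be given by formulas meaningful just there. *)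
Lemma dense_analytic_of_attained_sup (X : normedModType R) (P : set X)
    (g : nat -> X -> R) (c C : R) :
  P 0 -> (forall l x y, P x -> P y -> P (l *: x + y)) -> dense P -> 0 < c ->
  (forall n l x y, P x -> P y -> g n (l *: x + y) = l * g n x + g n y) ->
  (forall n x, P x -> `|g n x| <= C * `|x|) ->
  (forall x, P x -> exists n, (forall m, `|g m x| <= `|g n x|) /\ c * `|x| <= `|g n x|) ->
  has_dense_analytic_subspace X.
Proof.
move=> P0 PD dP c0 glin gC gmax.
pose S : {pred X} := [pred x | `[< P x >]].
have subS : submod_closed S.
  split; first exact/asboolP.
  by move=> l x y /asboolP Px /asboolP Py; apply/asboolP/PD.
pose mS := GRing.isSubmodClosed.Build R X S subS.
pose Y : submodClosed X := HB.pack S mS.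
have PY (x : lin_subspace Y) : P (val x) by exact/asboolP/(valP x).
exists Y; split.
  rewrite (_ : [set x | _] = P)//; apply/seteqP; split => x /=; first by move/asboolP.
  by move=> ?; apply/asboolP.
apply: (@analytic_renorming_of_attained_sup R _ (fun n (y : lin_subspace Y) => g n (val y)) c C) => //.
- by move=> n l x y; rewrite linearP/= glin; [|exact: PY|exact: PY].
- by move=> n y; exact: gC.
- by move=> y; exact: gmax.
Qed.

Lemma finite_range_max (a : nat -> R) (s : seq R) :
  (forall n, a n \in s) -> exists n, forall m, a m <= a n.
Proof.
(* Generalized for the induction: [k] is the best index so far, and each value is still in the list
   or at most [a k]. *)
move=> as_; have : forall n, a n \in s \/ a n <= a 0%N by left.
move: 0%N => {as_}; elim: s => [|z s IH] k H.
  by exists k => m; have [] := H m.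
have [[k' [ak' lt]]|no] := pselect (exists k', a k' = z /\ a k < z).
  apply: (IH k') => n; have [|le] := H n.
    by rewrite inE => /predU1P[->|]; [right; rewrite ak'|left].
  by right; rewrite ak' (le_trans le)// ltW.
apply: (IH k) => n; have [|le] := H n; last by right.
rewrite inE => /predU1P[an|]; last by left.
right; rewrite leNgt; apply/negP => lt; apply: no; exists n; split => //.
by rewrite -an.
Qed.

Lemma finite_net (M e : R) : 0 < e ->
  exists s : seq R, forall x, `|x| <= M -> exists2 y, y \in s & `|x - y| <= e.
Proof.
move=> e0; exists [seq e * k%:R - M | k <- iota 0 (Num.truncn (2 * M / e)).+1] => x.
rewrite ler_norml => /andP[Mx xM].
have z0 : 0 <= (x + M) / e by rewrite divr_ge0 ?(ltW e0)//; lra.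
have /andP[t1 t2] := truncn_itv z0.
exists (e * (Num.truncn ((x + M) / e))%:R - M).
  apply/mapP; exists (Num.truncn ((x + M) / e)) => //.
  rewrite mem_iota/= add0n ltnS; apply: le_truncn.
  rewrite ler_pM2r ?invr_gt0//; lra.
move: t1 t2; rewrite ler_pdivlMr// ltr_pdivrMr// -natr1 => t1 t2.
by rewrite ler_norml; apply/andP; split; lra.
Qed.

(** Rounding all coordinates into one finite net gives density; a finitely valued sequence attains
    its supremum. *)
Lemma ell_infty_dense_analytic : has_dense_analytic_subspace (ell_infty R).
Proof.
pose P := [set u : ell_infty R | exists s : seq R, forall n, val u n \in s].
apply: (@dense_analytic_of_attained_sup _ P (fun n u => val u n) 1 1) => //.
- by exists [:: 0] => n; rewrite inE.
- move=> l u v [s us] [s' vs']; exists [seq l * x + y | x <- s, y <- s'] => n.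
  apply/allpairsP; exists (val u n, val v n); split; [exact: us|exact: vs'|].
  by [].
- apply: dense_ball => u e e0.
  have [s hs] := finite_net `|u| e0.
  have ex n : exists y, y \in s /\ `|val u n - y| <= e.
    by have [y ? ?] := hs _ (ell_infty_ub u n); exists y.
  have [v hv] := choice ex.
  have bv : v \in @bounded_seq R.
    apply/bounded_seqP; exists (`|u| + e) => n.
    rewrite -[v n](subKr (val u n)) (le_trans (ler_normB _ _))// lerD//.
      exact: ell_infty_ub.
    exact: (hv n).2.
  exists (exist _ v bv : ell_infty R); first by exists s => n; exact: (hv n).1.
  apply: ell_infty_lub => n; exact: (hv n).2.
- by move=> n u _; rewrite mul1r; exact: ell_infty_ub.
- move=> u [s us].
  have [n hn] := @finite_range_max (fun n => `|val u n|) [seq `|x| | x <- s]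
    (fun n => map_f _ (us n)).
  by exists n; split => //; rewrite mul1r; exact: ell_infty_lub.
Qed.

End DenseAnalytic.

(** * The space ell_1 *)

Section SignFunctions.
Context {R : realType}.

(** The sign changes at each cut. Rational cuts give only countably many functions and still
    separate any two reals. *)
Definition cut_sign (s : seq rat) (x : R) : R :=
  \prod_(q <- s) (if x < ratr q then -1 else 1).

Lemma cut_sign_abs s x : `|cut_sign s x| = 1.
Proof.
by rewrite normr_prod big1// => q _; case: ifP; rewrite ?normrN normr1.
Qed.

(* By induction on [xs]: a cut between the first two points flips the sign at
   the first point only. *)
Lemma cut_sign_pattern (xs : seq R) (eps : R -> R) :
  sorted <%R xs -> (forall x, eps x = 1 \/ eps x = -1) ->
  exists s (a : R), `|a| = 1 /\ forall x, x \in xs -> cut_sign s x = a * eps x.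
Proof.
move=> + heps; elim: xs => [_|x xs IH].
  by exists [::], 1; rewrite normr1.
case: xs IH => [_ _|x' xs IH].
  exists [::], (eps x); split.
    by case: (heps x) => ->; rewrite ?normrN normr1.
  move=> y; rewrite inE => /eqP->; rewrite /cut_sign big_nil.
  by case: (heps x) => ->; ring.
move=> /= /andP[xx' sx']; have [s [a [a1 sa]]] := IH sx'.
have [q /andP[xq qx']] : exists q : rat, x < ratr q < x'.
  by have [q] := rat_in_itvoo xx'; rewrite in_itv/=; exists q.
have lt_xs y : y \in x' :: xs -> ratr q < y.
  rewrite inE => /predU1P[->//|yx]; apply: (lt_trans qx').
  have := sx'; rewrite (path_sortedE lt_trans) => /andP[/allP] /(_ _ yx) //.
have qs y : y \in x' :: xs -> cut_sign (q :: s) y = cut_sign s y.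
  by move=> yx; rewrite /cut_sign big_cons ltNge ltW ?mul1r// lt_xs.
have qx : cut_sign (q :: s) x = - cut_sign s x.
  by rewrite /cut_sign big_cons xq mulN1r.
have [sx|sx] : cut_sign s x = a * eps x \/ cut_sign s x = - (a * eps x).
  have : `|cut_sign s x| = `|a * eps x|.
    by rewrite cut_sign_abs normrM a1 mul1r; case: (heps x) => ->; rewrite ?normrN normr1.
  by move=> /eqP; rewrite eqr_norm2 => /orP[] /eqP; [left|right].
- exists s, a; split => // y; rewrite inE => /predU1P[->//|]; exact: sa.
- exists (q :: s), a; split => // y; rewrite inE => /predU1P[->|yx].
    by rewrite qx sx opprK.
  by rewrite qs// sa.
Qed.

End SignFunctions.

Section EllOne.
Context {R : realType} {T : choiceType}.

Definition fin_supp (f : T -> R) := exists s : seq T, uniq s /\ forall x, x \notin s -> f x = 0.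

Lemma fin_suppD l f g : fin_supp f -> fin_supp g -> fin_supp (l *: f + g).
Proof.
move=> [s [us hs]] [s' [us' hs']]; exists (undup (s ++ s')); split; first exact: undup_uniq.
move=> x; rewrite mem_undup mem_cat negb_or => /andP[/hs fx /hs' gx].
by rewrite !fctE/= fx gx scaler0 addr0.
Qed.

Lemma fin_supp_common f g : fin_supp f -> fin_supp g ->
  exists s : seq T, [/\ uniq s, forall x, x \notin s -> f x = 0 & forall x, x \notin s -> g x = 0].
Proof.
move=> [s [us hs]] [s' [us' hs']]; exists (undup (s ++ s')); split; first exact: undup_uniq.
  by move=> x; rewrite mem_undup mem_cat negb_or => /andP[/hs].
by move=> x; rewrite mem_undup mem_cat negb_or => /andP[_ /hs'].
Qed.

Lemma fsum_supp (f : T -> R) (s : seq T) : uniq s ->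
  (forall x, x \notin s -> f x = 0) -> \sum_(x \in [set: T]) f x = \sum_(x <- s) f x.
Proof.
move=> us hs; rewrite (fsbigE s)//; last by move=> x _ /hs.
by apply: eq_bigl => x; rewrite in_setT.
Qed.

Lemma ell1_norm_supp (f : ell1 R T) (s : seq T) : uniq s ->
  (forall x, x \notin s -> val f x = 0) -> `|f| = \sum_(x <- s) `|val f x|.
Proof.
move=> us hs; apply: EFin_inj; rewrite -[LHS]/(ell1_norm f)%:E ell1_normE /ell1_enorm.
rewrite (esumID [set` s])// addeC [X in (X + _)%E]esum1 ?add0e; last first.
  by move=> x [_ /= /negP /hs ->]; rewrite normr0.
rewrite setTI esum_fset//.
by rewrite -fsbig_seq// sumEFin.
Qed.

Lemma summable_fin_supp (f : T -> R) : fin_supp f -> f \in @summable_fun R T.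
Proof.
move=> [s [us hs]]; apply/summable_funP; rewrite /ell1_enorm (esumID [set` s])//.
rewrite addeC [X in (X + _)%E]esum1 ?add0e; last first.
  by move=> x [_ /= /negP /hs ->]; rewrite normr0.
by rewrite setTI esum_fset// -fsbig_seq// sumEFin ltry.
Qed.

(** The norm is a supremum of finite partial sums, so some finite [A] carries all but [e] of it; [f]
    is restricted to [A]. *)
Lemma fin_supp_dense : dense [set f : ell1 R T | fin_supp (val f)].
Proof.
apply: dense_ball => f e e0.
have ffin := summable_fun_fin (valP f).
have [_ [A [finA _] <-] Af] := ub_ereal_sup_adherent e0 ffin.
rewrite -/(esum _ _) -/(ell1_enorm _) in Af.
pose g x := if x \in A then val f x else 0.
have gsupp : fin_supp g.
  have [s As] := (finite_seqP _).1 finA.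
  exists (undup s); split; first exact: undup_uniq.
  by move=> x; rewrite mem_undup /g As mem_setE => /negbTE ->.
exists (exist _ g (summable_fin_supp gsupp) : ell1 R T) => //.
rewrite -lee_fin -[X in (X <= _)%E]/(ell1_norm _)%:E ell1_normE /=.
rewrite /ell1_enorm (esumID A)// setTI esum1 ?add0e; last first.
  by move=> x Ax /=; rewrite !fctE /g mem_set// subrr normr0.
have split_f : ell1_enorm (val f) =
    (\sum_(x \in A) `|(val f x)%:E| + \esum_(x in ~` A) `|(val f x)%:E|)%E.
  by rewrite /ell1_enorm (esumID A)// !setTI esum_fset.
rewrite setTI (eq_esum (b := fun x => `|(val f x)%:E|%E)); last first.
  by move=> x Ax /=; rewrite !fctE /g memNset// subr0.
have A0 : (0 <= \sum_(x \in A) `|(val f x)%:E|)%E by exact: fsume_ge0.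
have B0 : (0 <= \esum_(x in ~` A) `|(val f x)%:E|)%E by exact: esum_ge0.
move: Af ffin A0 B0; rewrite split_f.
case: (\sum_(x \in A) _)%E => [p| |]; case: (\esum_(x in _) _)%E => [q| |] //=.
by rewrite lte_fin !lee_fin => lt_pe _ _ _; lra.
Qed.

(** Signs are transported along an injection [h] into the reals. Some cut function agrees with the
    signs of [f] on its support up to a global sign, so the corresponding functional attains the
    norm. *)
Lemma ell1_dense_analytic : ([set: T] #= [set: R])%card ->
  has_dense_analytic_subspace (ell1 R T).
Proof.
rewrite card_eq_le => /andP[/pcard_leTP[h0] _].
have h_inj : injective h0 by move=> x y xy; apply: (@inj _ _ _ h0) => //; rewrite in_setT.
set h : T -> R := h0.
(* A number that encodes no list of rationals gets the empty list, hence the constant sign [1]. *)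
pose sg n x := cut_sign (odflt [::] (unpickle n : option (seq rat))) (h x).
pose phi n (f : ell1 R T) := \sum_(x \in [set: T]) sg n x * val f x.
have phiE n (f : ell1 R T) s : uniq s -> (forall x, x \notin s -> val f x = 0) ->
    phi n f = \sum_(x <- s) sg n x * val f x.
  by move=> us hs; apply: fsum_supp => // x /hs ->; rewrite mulr0.
have phi_le n (f : ell1 R T) : fin_supp (val f) -> `|phi n f| <= `|f|.
  move=> [s [us hs]]; rewrite (phiE n f s us hs) (ell1_norm_supp us hs).
  rewrite (le_trans (ler_norm_sum _ _ _))// ler_sum// => x _.
  by rewrite normrM cut_sign_abs mul1r.
apply: (@dense_analytic_of_attained_sup R (ell1 R T)
  [set f | fin_supp (val f)] phi 1 1) => //.
- by exists [::].
- by move=> l f g; exact: fin_suppD.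
- exact: fin_supp_dense.
- move=> n l f g hf hg; have [s [us fs gs]] := fin_supp_common hf hg.
  rewrite (phiE n f s)// (phiE n g s)// (phiE n _ s)//; last first.
    by move=> x xs; have -> : val (l *: f + g) x = l * val f x + val g x by []; rewrite fs// gs// mulr0 addr0.
  rewrite mulr_sumr -big_split/=; apply: eq_bigr => x _.
  by have -> : (l *: sval f + sval g) x = l * sval f x + sval g x by []; ring.
- by move=> n f hf; rewrite mul1r; exact: phi_le.
move=> f fsupp; have [s [us hs]] := fsupp.
pose eps y : R := if `[< exists x, h x = y /\ val f x < 0 >] then -1 else 1.
have [||q [a [a1 qa]]] := @cut_sign_pattern R (sort <=%R [seq h x | x <- s]) eps.
- rewrite lt_sorted_uniq_le sort_uniq map_inj_uniq// us/=.
  by apply: sort_sorted; exact: le_total.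
- by move=> y; rewrite /eps; case: ifP; [right|left].
have norm_f : `|phi (pickle q) f| = `|f|.
  rewrite (phiE _ _ s)// (ell1_norm_supp us hs).
  have -> : \sum_(x <- s) sg (pickle q) x * val f x = a * \sum_(x <- s) `|val f x|.
    rewrite mulr_sumr; apply: eq_big_seq => x xs.
    rewrite /sg pickleK/= qa; last by rewrite mem_sort map_f.
    rewrite -mulrA; congr (_ * _); rewrite /eps; case: ifPn => [/asboolP[y [hy fy]]|/asboolPn no].
      by move: fy; rewrite (h_inj _ _ hy) => fy; rewrite ltr0_norm// mulN1r.
    rewrite mul1r ger0_norm// leNgt; apply/negP => fx; apply: no; by exists x.
  by rewrite normrM a1 mul1r ger0_norm// sumr_ge0.
by exists (pickle q); rewrite norm_f mul1r; split => // m; exact: phi_le.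
Qed.

End EllOne.

(** * Separable spaces *)

Section HahnBanach.
Context {R : realType} {X : lmodType R}.
Implicit Types (p q : X -> R) (x y : X).

Definition sublinear p :=
  (forall x y, p (x + y) <= p x + p y) /\
  (forall c x, 0 < c -> p (c *: x) <= c * p x).

Lemma sublinearZ p c x : sublinear p -> 0 < c -> p (c *: x) = c * p x.
Proof.
move=> [_ pZ] c0; apply/le_anti; rewrite pZ//=.
have := pZ c^-1 (c *: x); rewrite scalerA mulVf ?gt_eqF// scale1r invr_gt0.
by move=> /(_ c0); rewrite ler_pdivlMl.
Qed.

Lemma sublinear0 p : sublinear p -> p 0 = 0.
Proof.
move=> hp; have := sublinearZ 0 hp (ltr0Sn R 1); rewrite scaler0; lra.
Qed.

Lemma sublinear_ge p x : sublinear p -> - p (- x) <= p x.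
Proof.
move=> hp; rewrite lerNl -subr_ge0 opprK addrC -(sublinear0 hp) -(subrr x).
exact: hp.1.
Qed.

(* The largest sublinear minorant of [p] that takes the value [- p y] at [- y]. *)
Definition sublinear_shift p y x :=
  inf [set p (x + t *: y) - t * p y | t in [set t : R | 0 <= t]].

Lemma sublinear_shift_le p y x t : sublinear p -> 0 <= t ->
  sublinear_shift p y x <= p (x + t *: y) - t * p y.
Proof.
move=> hp t0; apply: ge_inf; last by exists t.
exists (- p (- x)) => _ [s /= s0 <-].
have -> : s * p y = p (s *: y).
  move: s0; rewrite le_eqVlt => /predU1P[<-|s0]; last by rewrite sublinearZ.
  by rewrite scale0r mul0r sublinear0.
by have := hp.1 (x + s *: y) (- x); rewrite addrC addKr; lra.
Qed.

Lemma le_sublinear_shift p y x b :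
  (forall t, 0 <= t -> b <= p (x + t *: y) - t * p y) -> b <= sublinear_shift p y x.
Proof.
move=> H; apply: lb_le_inf; first by exists (p (x + 0 *: y) - 0 * p y), 0 => /=.
by move=> _ [t /= t0 <-]; exact: H.
Qed.

Lemma sublinear_shift_sublinear p y : sublinear p -> sublinear (sublinear_shift p y).
Proof.
move=> hp; split=> [x x'|c x c0].
  rewrite -lerBlDr; apply: le_sublinear_shift => t t0.
  rewrite lerBlDr -lerBlDl; apply: le_sublinear_shift => s s0.
  rewrite lerBlDl (le_trans (sublinear_shift_le _ _ hp (addr_ge0 t0 s0)))//.
  have := hp.1 (x + t *: y) (x' + s *: y).
  by rewrite addrACA -scalerDl; lra.
rewrite -ler_pdivrMl//; apply: le_sublinear_shift => t t0.
rewrite ler_pdivrMl// (le_trans (sublinear_shift_le _ _ hp (mulr_ge0 (ltW c0) t0)))//.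
by rewrite -scalerA -scalerDr sublinearZ// mulrBr mulrA.
Qed.

Lemma sublinear_shift_minor p y x : sublinear p -> sublinear_shift p y x <= p x.
Proof.
move=> hp; have := sublinear_shift_le y x hp (lexx 0).
by rewrite scale0r addr0 mul0r subr0.
Qed.

(** A minimal sublinear minorant [q], given by Zorn's lemma, equals each of its shifts, and this is
    the reverse of subadditivity. *)
Lemma exists_additive_minorant p : sublinear p ->
  exists q, [/\ sublinear q, forall x, q x <= p x & forall x y, q (x + y) = q x + q y].
Proof.
move=> hp; pose T := {q : X -> R | sublinear q /\ forall x, q x <= p x}.
(* The order is reversed, so that a maximal element is a minimal functional. *)
pose rel (q r : T) := `[< forall x, sval r x <= sval q x >].
have [||||[q [hq qp]] qmin] := @Zorn T rel.
- by move=> q; apply/asboolP => x.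
- by move=> q r s /asboolP qr /asboolP rs; apply/asboolP => x; exact: le_trans (qr x).
- move=> [q hq] [r hr] /asboolP /= qr /asboolP /= rq; apply/eq_exist/funext => x.
  by apply/le_anti; rewrite qr rq.
- move=> A totA.
  have [[a Aa]|A0] := pselect (A !=set0); last first.
    exists (exist _ p (conj hp (fun x => lexx (p x)))) => s As.
    by case: A0; exists s.
  pose V x := [set sval r x | r in A].
  have Vlb x : has_lbound (V x).
    exists (- p (- x)) => _ [[r [hr rp]] /= _ <-].
    by rewrite (le_trans _ (sublinear_ge x hr))// lerN2.
  have V0 x : V x !=set0 by exists (sval a x), a.
  have Vle r x : A r -> inf (V x) <= sval r x by move=> Ar; apply: ge_inf => //; exists r.
  have hinf : sublinear (fun x => inf (V x)).
    split=> [x y|c x c0].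
      rewrite -lerBlDr; apply: lb_le_inf => // _ [r Ar <-].
      rewrite lerBlDr -lerBlDl; apply: lb_le_inf => // _ [s As <-]; rewrite lerBlDl.
      have [/asboolP rs|/asboolP sr] := totA _ _ Ar As.
        rewrite (le_trans (Vle s _ As))// (le_trans ((svalP s).1.1 x y))// lerD2r.
        exact: rs.
      rewrite (le_trans (Vle r _ Ar))// (le_trans ((svalP r).1.1 x y))// lerD2l.
      exact: sr.
    rewrite -ler_pdivrMl//; apply: lb_le_inf => // _ [r Ar <-].
    by rewrite ler_pdivrMl// -(sublinearZ _ (svalP r).1)// Vle.
  have infp x : inf (V x) <= p x.
    by rewrite (le_trans (Vle a x Aa))//; exact: (svalP a).2.
  by exists (exist _ (fun x => inf (V x)) (conj hinf infp) : T) => s As; apply/asboolP => x /=; exact: Vle.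
exists q; split => // x y; apply/le_anti; rewrite hq.1/=.
have hs := sublinear_shift_sublinear y hq.
have sp z : sublinear_shift q y z <= p z.
  exact: le_trans (sublinear_shift_minor _ _ hq) (qp z).
have /(congr1 sval)/= e := qmin (exist _ (sublinear_shift q y) (conj hs sp) : T)
  (introT (asboolP _) (fun z => sublinear_shift_minor y z hq)).
have := sublinear_shift_le y x hq ler01.
by rewrite e scale1r mul1r lerBrDr.
Qed.

End HahnBanach.

(** Shifting the norm along [w] first makes the value at [- w] at most minus the norm of [w]; an
    additive minorant [g] inherits this, so [g w] is the full norm. *)
Lemma exists_norming_functional (R : realType) (X : normedModType R) (w : X) :
  exists g : X -> R, [/\ linear (g : X -> R^o), forall x, `|g x| <= `|x| & g w = `|w|].
Proof.
have hn : sublinear (fun x : X => `|x|).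
  by split=> [x y|c x c0]; rewrite ?ler_normD// normrZ gtr0_norm.
have hp := sublinear_shift_sublinear w hn.
have [g [hg gp gD]] := exists_additive_minorant hp.
have g_le x : g x <= `|x| by exact: le_trans (gp x) (sublinear_shift_minor _ _ hn).
have g0 := sublinear0 hg.
have gN x : g (- x) = - g x.
  by apply/eqP; rewrite -addr_eq0 addrC -gD subrr g0.
exists g; split.
- move=> c x y; rewrite gD; congr (_ + _).
  have [c0|c0|->] := ltgtP c 0.
  + by rewrite -[c]opprK scaleNr gN (sublinearZ _ hg) ?oppr_gt0// -mulNr.
  + exact: sublinearZ.
  + by rewrite !scale0r g0.
- by move=> x; rewrite ler_norml g_le lerNl -gN -[leRHS]normrN g_le.
- apply/le_anti; rewrite g_le/= -[g w]opprK -gN lerNr (le_trans (gp _))//.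
  have := sublinear_shift_le w (- w) hn ler01.
  by rewrite scale1r addNr normr0 mul1r sub0r.
Qed.

(** * A dense subspace with finitely valued norming functionals *)

Section SeparableSpace.
Context {R : realType} {X : normedModType R}.

Lemma separable_dense_seq : separable X -> exists d : nat -> X,
  forall x (e : R), 0 < e -> exists k, `|x - d k| < e.
Proof.
move=> [D /countable_injP[f f_inj] dD].
(* The injection of [D] into the naturals is inverted; numbers outside its image get the default
   [0]. *)
exists (fun n => xget 0 [set x | D x /\ f x = n]) => x e e0.
have [||y [xy Dy]] := dD (ball x e).
- by exists x; exact: ballxx.
- exact: ball_open.
exists (f y); case: xgetP => [z _ [Dz fz]|/(_ y)[]//].
by have -> : z = y; [apply: f_inj fz; rewrite inE|move: xy; rewrite -ball_normE].
Qed.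

Lemma separable_dense_analytic : separable X -> has_dense_analytic_subspace X.
Proof.
move=> /separable_dense_seq[d dd].
have [G HG] := choice (@exists_norming_functional R X).
have Glin w c x y : G w (c *: x + y) = c * G w x + G w y by have [->] := HG w.
have Gle w x : `|G w x| <= `|x| by have [] := HG w.
have Gw w : G w w = `|w| by have [] := HG w.
(* [P n] kills [d 0, ..., d n.-1], and [a n] is the coordinate along [e n] in the
   expansion of [x - P m x]. *)
pose P := fix P n : X -> X := if n is m.+1 then fun x =>
  let w := P m (d m) in P m x - (G w (P m x) / `|w|) *: w else id.
pose a n x := G (P n (d n)) (P n x).
(* If [P n (d n) = 0] then [e n = 0], and step [n] changes nothing. *)
pose e n := `|P n (d n)|^-1 *: P n (d n).
have PS n x : P n.+1 x = P n x - a n x *: e n by rewrite /a /e scalerA.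
have G0 w : G w 0 = 0.
  by have := Glin w (-1) 0 0; rewrite scaler0 addr0 mulN1r addNr.
have Plin n c x y : P n (c *: x + y) = c *: P n x + P n y.
  by elim: n => // n IH; rewrite !PS /a IH Glin scalerBr scalerDl -scalerA opprD addrACA.
have alin n c x y : a n (c *: x + y) = c * a n x + a n y by rewrite /a Plin Glin.
have e_le n : `|e n| <= 1.
  rewrite normrZ normfV normr_id; have [->|w0] := eqVneq (P n (d n)) 0.
    by rewrite normr0 mulr0.
  by rewrite mulVf// normr_eq0.
have P_le n x : `|P n x| <= 2 ^+ n * `|x|.
  elim: n => [|n IH]; first by rewrite expr0 mul1r.
  rewrite PS (le_trans (ler_normB _ _))// exprS -mulrA mulr_natl mulr2n lerD//.
  rewrite normrZ -[leRHS]mulr1 ler_pM//; exact: le_trans (Gle _ _) IH.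
have a_le n x : `|a n x| <= 2 ^+ n * `|x| by exact: le_trans (Gle _ _) (P_le n x).
have Pd n : P n.+1 (d n) = 0.
  rewrite PS /a /e Gw scalerA; have [->|w0] := eqVneq (P n (d n)) 0.
    by rewrite scaler0 subr0.
  by rewrite divff ?normr_eq0// scale1r subrr.
have P0 m n x : P m x = 0 -> (m <= n)%N -> P n x = 0.
  move=> Pm /subnK <-; elim: (n - m)%N => // k IH.
  by rewrite addSn PS /a IH G0 scale0r subr0.
have expand m x : P m x = 0 -> x = \sum_(0 <= n < m) a n x *: e n.
  move=> Pm; have : x = \sum_(0 <= n < m) a n x *: e n + P m x.
    elim: {Pm}m => [|m IH]; first by rewrite big_geq// add0r.
    by rewrite big_nat_recr// PS -addrA [_ *: _ + (_ - _)]addrC subrK.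
  by rewrite Pm addr0.
(* The first factor cancels the growth [2 ^+ n] of [a n]; the second one sums to at most [1 / 2]. *)
pose eps n : R := 2^-1 ^+ n * 2^-1 ^+ n.+2.
have eps0 n : 0 < eps n by rewrite mulr_gt0// exprn_gt0// invr_gt0.
have [L HL] := choice (fun n => finite_net 1 (eps0 n)).
(* Moving the values [G (d k) (e n)] into a finite net [L n] independent of [k]
   makes [k |-> f k x] finitely valued when the expansion of [x] is finite. *)
have ex (kn : nat * nat) : exists s, s \in L kn.2 /\ `|G (d kn.1) (e kn.2) - s| <= eps kn.2.
  have [s sL sle] := HL kn.2 _ (le_trans (Gle (d kn.1) (e kn.2)) (e_le _)).
  by exists s.
have [s Hs] := choice ex.
pose S := [set x | exists m, P m x = 0].
(* [xget] picks any [m] with [P m x = 0]; the choice does not matter since [a n x] vanishes from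
   such an [m] on. Outside [S] the value is an empty sum. *)
pose f k x := \sum_(0 <= n < xget 0%N [set m | P m x = 0]) a n x * s (k, n).
have fE k x m : P m x = 0 -> f k x = \sum_(0 <= n < m) a n x * s (k, n).
  move=> Pm; rewrite /f; case: xgetP => [m' _ /= Pm'|/(_ m)//].
  have aux i j : P i x = 0 -> (i <= j)%N ->
      \sum_(0 <= n < i) a n x * s (k, n) = \sum_(0 <= n < j) a n x * s (k, n).
    move=> Pi ij; rewrite [RHS](@big_cat_nat _ _ _ i)//= [X in _ + X]big_nat [X in _ + X]big1 ?addr0//.
    by move=> n /andP[in_ _]; rewrite /a (P0 _ _ _ Pi in_) G0 mul0r.
  by have [/aux->|/ltnW/aux->] := leqP m' m.
have Gsum k m x : G (d k) (\sum_(0 <= n < m) a n x *: e n) =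
    \sum_(0 <= n < m) a n x * G (d k) (e n).
  elim: m => [|m IH]; first by rewrite !big_geq.
  by rewrite !big_nat_recr//= addrC Glin IH addrC.
have fG k x : S x -> `|f k x - G (d k) x| <= `|x| / 2.
  move=> [m Pm]; rewrite (fE _ _ _ Pm) [X in G _ X](expand _ _ Pm) Gsum -sumrB.
  rewrite (le_trans (ler_norm_sum _ _ _))//.
  apply: (@le_trans _ _ (\sum_(0 <= n < m) `|x| * 2^-1 ^+ n.+2)).
    apply: ler_sum => n _; rewrite -mulrBr normrM distrC.
    apply: (@le_trans _ _ (2 ^+ n * `|x| * eps n)).
      by rewrite ler_pM//; exact: (Hs (k, n)).2.
    rewrite /eps mulrACA exprVn divff ?mul1r// expf_neq0//.
  rewrite -mulr_sumr ler_wpM2l//.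
  suff -> : \sum_(0 <= n < m) 2^-1 ^+ n.+2 = 2^-1 - 2^-1 ^+ m.+1 :> R.
    by rewrite gerBl// exprn_ge0// invr_ge0.
  elim: m {Pm} => [|m IH]; first by rewrite big_geq// expr1 subrr.
  by rewrite big_nat_recr//= IH !exprS; field.
have SD c x y : S x -> S y -> S (c *: x + y).
  move=> [m Pm] [m' Pm']; exists (maxn m m').
  by rewrite Plin (P0 _ _ _ Pm (leq_maxl _ _)) (P0 _ _ _ Pm' (leq_maxr _ _)) scaler0 addr0.
(* The upper constant comes from [1 + 1 / 2 <= 2], the lower one from
   [1 - 1 / 8 - 1 / 8 - 1 / 2 = 1 / 4], with [d k] within an eighth of the norm of [x]. *)
apply: (@dense_analytic_of_attained_sup R X S f 4^-1 2) => //.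
- by exists 0%N.
- apply: dense_ball => x r r0; have [k xk] := dd x r r0.
  by exists (d k); [exists k.+1|exact: ltW].
- move=> k c x y [m Pm] [m' Pm'].
  have Px := P0 _ _ _ Pm (leq_maxl m m'); have Py := P0 _ _ _ Pm' (leq_maxr m m').
  rewrite (fE _ _ _ Px) (fE _ _ _ Py) (fE _ _ (maxn m m')); last first.
    by rewrite Plin Px Py scaler0 addr0.
  rewrite mulr_sumr -big_split/=; apply: eq_bigr => n _.
  by rewrite alin mulrDl mulrA.
- move=> k x Sx; rewrite -[f k x](subrK (G (d k) x)).
  rewrite (le_trans (ler_normD _ _))//.
  by have := fG k x Sx; have := Gle (d k) x; have := normr_ge0 x; lra.
move=> x Sx; have [m Pm] := Sx.
(* The list collects the sums of [a n x * v] with [v] in [L n], a choice independent of [k]. *)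
have [l hl] : exists l : seq R, forall k, f k x \in l.
  have : exists l : seq R, forall k, \sum_(0 <= n < m) a n x * s (k, n) \in l.
    elim: {Pm}m => [|m [l IH]]; first by exists [:: 0] => k; rewrite big_geq// inE.
    exists [seq u + a m x * v | u <- l, v <- L m] => k.
    rewrite big_nat_recr//=; apply/allpairsP.
    exists (\sum_(0 <= n < m) a n x * s (k, n), s (k, m)).
    by split; [exact: IH|exact: (Hs (k, m)).1|].
  by move=> [l hl]; exists l => k; rewrite (fE _ _ _ Pm).
have [n hn] := @finite_range_max R (fun k => `|f k x|) [seq `|y| | y <- l]
  (fun k => map_f _ (hl k)).
exists n; split => //.
have [x0|x0] := eqVneq x 0; first by rewrite x0 normr0 mulr0.
have x_gt0 : 0 < `|x| by rewrite normr_gt0.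
have [|k xk] := dd x (`|x| / 8); first by rewrite divr_gt0.
rewrite (le_trans _ (hn k))//.
have h1 := fG k x Sx.
have h2 : `|d k| - `|x| / 8 <= G (d k) x.
  have := Glin (d k) (-1) x (d k); rewrite scaleN1r Gw mulN1r addrC => h.
  have := Gle (d k) (d k - x); rewrite h distrC ler_norml => /andP[_].
  by move: xk; lra.
have h3 : `|x| - `|x| / 8 <= `|d k|.
  by have := lerB_dist x (d k); move: xk; lra.
have h4 : G (d k) x <= `|f k x| + `|x| / 2.
  have := h1; rewrite distrC => h5.
  have := ler_norm (G (d k) x - f k x); have := ler_norm (f k x); lra.
lra.
Qed.

End SeparableSpace.

Theorem theoremA (R : realType) :
  [/\ has_dense_analytic_subspace (ell_infty R),
      forall X : completeNormedModType R,
        separable X -> has_dense_analytic_subspace X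
    & forall T : choiceType, ([set: T] #= [set: R])%card ->
        has_dense_analytic_subspace (ell1 R T)].
Proof.
split; first exact: ell_infty_dense_analytic.
- by move=> X; exact: separable_dense_analytic.
- by move=> T; exact: ell1_dense_analytic.
Qed.
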